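(* Let $A$ be a unital operator algebra and denote by $A^\times$ its group of invertible elements. Consider an amenable topological group $G$ and denote $$\mathcal R:=\{\rho\colon G\to A^\times\mid\rho\text{ continuous group homomorphism and }\sup_{g\in G}\|\rho(g)\|<\infty\}.$$ Assume that one of the following conditions is satisfied: (i) $A$ is a dual operator algebra, or (ii) $G$ is compact. Then the orbits of the action $$A^\times\times\mathcal R\to\mathcal R,\qquad(a,\rho)\mapsto a\cdot\rho(\cdot)\cdot a^{-1},$$ have natural structures of Banach manifolds that are smoothly acted on by the Banach-Lie group $A^\times$.
   Context: An operator space is a complex vector space $X$ with a complete norm on each matrix space $M_n(X)$, $n\ge1$, such that for some Hilbert space $\mathcal H$ there is a linear map $X\to\mathcal B(\mathcal H)$ whose entrywise amplifications $M_n(X)\to M_n(\mathcal B(\mathcal H))=\mathcal B(\mathcal H^{(n)})$ are all isometric (such a map between operator spaces is called completely isometric). An operator algebra is an associative algebra $A$ endowed with an operator space structure such that there exists a completely isometric homomorphism $A\to\mathcal B(\mathcal H)$ for some Hilbert space $\mathcal H$. It is a dual operator algebra if moreover $A$ is an operator space dual (the dual of an operator space, with its canonical operator space structure) and the homomorphism can be chosen to be, additionally, weak$^*$-continuous. Amenable topological group: for a topological group $G$, a bounded function $f\colon G\to\mathbb C$ and $t\in G$, put $(L_tf)(s)=f(ts)$. Let $\mathcal{RUC}_b(G)$ be the space of all bounded continuous $f\colon G\to\mathbb C$ such that $s\mapsto L_sf$ is continuous for the sup norm. $G$ is amenable if there is a linear functional $\mu$ on $\mathcal{RUC}_b(G)$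 with $\|\mu\|=\mu(\mathbf 1)=1$ and $\mu\circ L_t=\mu$ for all $t\in G$. A Banach manifold is a Hausdorff topological space with a maximal smooth atlas of local charts onto open subsets of real Banach spaces. A Banach-Lie group is a group that is also a Banach manifold such that multiplication and inversion are smooth; for a unital associative Banach algebra $A$, the group $A^\times$ of invertible elements is a Banach-Lie group. *)

(* Defs.v *)
From HB Require Import structures.
From mathcomp Require Import all_boot all_order all_algebra.
From mathcomp Require Import complex.
From mathcomp Require Import all_classical all_reals all_analysis.

Set Implicit Arguments.
Unset Strict Implicit.
Unset Printing Implicit Defensive.

Import Order.TTheory GRing.Theory Num.Theory.
Import numFieldNormedType.Exports.

Local Open Scope classical_set_scope.
Local Open Scope ring_scope.
Local Open Scope complex_scope.

(* The norm of a complex normed module takes values in R[i]; this is the same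
   norm with values in R. *)
Definition rnorm (R : realType) (X : normedModType R[i]) (x : X) : R :=
  complex.Re `|x|.

(* A complex Banach space seen as a real one: same points, addition and
   uniformity, scalars restricted to R, norm [rnorm]. *)
Definition realify (R : realType) (X : completeNormedModType R[i]) : Type := X.

Section realify.
Context (R : realType) (X : completeNormedModType R[i]).
Local Notation Y := (realify X).

Lemma rnormE (V : normedModType R[i]) (x : V) : (rnorm x)%:C = `|x|.
Proof. by rewrite /rnorm RRe_real ?normr_real. Qed.

HB.instance Definition _ := GRing.Zmodule.copy Y X.
HB.instance Definition _ := Complete.copy Y X.

Let rscale (a : R) (x : Y) : Y := a%:C *: (x : X).

Let rscaleA a b x : rscale a (rscale b x) = rscale (a * b) x.
Proof. by rewrite /rscale scalerA -rmorphM. Qed.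
Let rscale1 : left_id 1 rscale.
Proof. by move=> x; rewrite /rscale rmorph1 scale1r. Qed.
Let rscaleDr : right_distributive rscale +%R.
Proof. by move=> a x y; rewrite /rscale scalerDr. Qed.
Let rscaleDl x : {morph rscale^~ x : a b / a + b}.
Proof. by move=> a b; rewrite /rscale rmorphD scalerDl. Qed.

HB.instance Definition _ :=
  GRing.Zmodule_isLmodule.Build R Y rscaleA rscale1 rscaleDr rscaleDl.

Let norm (x : Y) : R := rnorm (x : X).

Let normE (x : Y) : (norm x)%:C = `|x : X|. Proof. exact: rnormE. Qed.

Let norm_triangle x y : norm (x + y) <= norm x + norm y.
Proof. by rewrite -lecR rmorphD/= !normE ler_normD. Qed.
Let norm_eq0 x : norm x = 0 -> x = 0.
Proof.
by move=> x0; apply/eqP; rewrite -[_ == _](normr_eq0 (x : X)) -normE x0.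
Qed.
Let normMn x n : norm (x *+ n) = norm x *+ n.
Proof. by apply: (@complexI R); rewrite rmorphMn/= !normE normrMn. Qed.
Let normN x : norm (- x) = norm x.
Proof. by apply: (@complexI R); rewrite !normE normrN. Qed.

HB.instance Definition _ :=
  Num.Zmodule_isNormed.Build R Y norm_triangle norm_eq0 normMn normN.

Let bal := ball_ (fun x : Y => `|x|).
Let balE x e : bal x e = ball (x : X) e%:C.
Proof.
by rewrite -ball_normE; apply/seteqP; split => y /=;
  rewrite -rnormE ltcR.
Qed.
Let bal_center x (e : R) : 0 < e -> bal x e x.
Proof. by move=> e0; rewrite /bal /ball_/= subrr normr0. Qed.
Let bal_sym x y (e : R) : bal x e y -> bal y e x.
Proof. by rewrite /bal /ball_/= distrC. Qed.
Let bal_triangle x y z e1 e2 :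
  bal x e1 y -> bal y e2 z -> bal x (e1 + e2) z.
Proof. by rewrite !balE rmorphD/=; exact: ball_triangle. Qed.
Let bal_ent : entourage = entourage_ bal.
Proof.
rewrite [LHS](_ : _ = @entourage X)// -entourage_ballE /entourage_.
apply/seteqP; split => E [e /= e0 eE].
  have [e1 e2] : e = (complex.Re e)%:C /\ 0 < complex.Re e.
    move: e0; rewrite ltcE/= => /andP[/eqP i0 r0]; split=> //.
    by case: e {eE r0} i0 => a b /= ->.
  exists (complex.Re e) => // xy exy; apply: eE => /=.
  by rewrite [e]e1 -balE.
exists e%:C => [|xy exy]; first by rewrite /= ltcR.
by apply: eE => /=; rewrite balE.
Qed.

HB.instance Definition _ := Uniform_isPseudoMetric.Build R Y
  bal_center bal_sym bal_triangle bal_ent.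
HB.instance Definition _ := NormedZmod_PseudoMetric_eq.Build R Y erefl.

Let normZ (a : R) (x : Y) : `|a *: x| = `|a| * `|x|.
Proof.
apply: (@complexI R); rewrite rmorphM/= [LHS]normE [X in _ = _ * X]normE.
by rewrite [LHS]normrZ normc_def/= expr0n/= addr0 sqrtr_sqr.
Qed.

HB.instance Definition _ :=
  PseudoMetricNormedZmod_Lmodule_isNormedModule.Build R Y normZ.
End realify.


(* The pointed topological structures on products are not declared. *)
HB.saturate prod.

Section prod_complete.
Context (K : numFieldType) (U V : completeNormedModType K).

Let prod_complete (F : set_system (U * V)%type) :
  ProperFilter F -> cauchy F -> cvg F.
Proof.
move=> FF cauchyF; have cF := (cauchyP F).1 cauchyF.
have c1 : cauchy (fst @ F).
  apply: cauchy_exP => e /cF[[x y]] xyF; exists x.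
  by apply: (@filterS _ F _ (ball (x, y) e)) xyF => z xyz; exact: (proj1 xyz).
have c2 : cauchy (snd @ F).
  apply: cauchy_exP => e /cF[[x y]] xyF; exists y.
  by apply: (@filterS _ F _ (ball (x, y) e)) xyF => z xyz; exact: (proj2 xyz).
apply/cvg_ex; exists (lim (fst @ F), lim (snd @ F)).
have -> : F = fmap (fun z => (z.1, z.2)) F.
  by apply/funext => A; congr (F _); apply/funext => -[].
by apply: cvg_pair; apply: cauchy_cvg.
Qed.

HB.instance Definition _ := Uniform_isComplete.Build (U * V)%type prod_complete.
End prod_complete.

(* Continuous linear maps; for real scalars they are normed by [opnorm]. *)
Section blin.
Context (K : numFieldType) (X Y : normedModType K).

Definition blin_pred : {pred X -> Y} :=
  [pred f | `[< linear f /\ continuous f >]].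

Record blin := Blin { blin_fun :> X -> Y; blinP : blin_fun \in blin_pred }.

HB.instance Definition _ := [isSub for blin_fun].
HB.instance Definition _ := [Choice of blin by <:].

Let blin_submod : submod_closed blin_pred.
Proof.
split.
  apply/asboolP; split; first by move=> a x y; rewrite scaler0 addr0.
  exact: cst_continuous.
move=> a f g /asboolP[lf cf] /asboolP[lg cg]; apply/asboolP; split.
  move=> b x y; rewrite !fctE lf lg !scalerDr addrACA !scalerA.
  by rewrite (mulrC a).
move=> x; apply: continuousD; last exact: cg.
by apply: continuousZr; exact: cf.
Qed.

HB.instance Definition _ := GRing.isSubmodClosed.Build K (X -> Y) blin_pred
  blin_submod.
HB.instance Definition _ := [SubChoice_isSubLmodule of blin by <:].

Lemma blin_linear (f : blin) : linear f.
Proof. by have /asboolP[] := blinP f. Qed.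
Lemma blin_continuous (f : blin) : continuous f.
Proof. by have /asboolP[] := blinP f. Qed.

HB.instance Definition _ (f : blin) :=
  GRing.isLinear.Build K X Y *:%R f (blin_linear f).

End blin.

Section blin_norm.
Context (R : realType) (X Y : normedModType R).
Local Notation L := (blin X Y).

Definition opnorm (f : L) : R := sup [set `|f x| | x in [set x | `|x| <= 1]].

Let nonempty (f : L) : [set `|f x| | x in [set x | `|x| <= 1]] !=set0.
Proof. by exists `|f 0|; exists 0 => //=; rewrite normr0. Qed.

Lemma opnorm_has_sup (f : L) :
  has_sup [set `|f x| | x in [set x | `|x| <= 1]].
Proof.
split; first exact: nonempty.
have /bounded_funP/(_ 1)[M fM] := continuous_linear_bounded 0
  (@blin_continuous _ _ _ f 0).
by exists M => _ [x x1 <-]; exact: fM.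
Qed.

Lemma opnorm_ge (f : L) x : `|f x| <= opnorm f * `|x|.
Proof.
have [->|x0] := eqVneq x 0; first by rewrite linear0 !normr0 mulr0.
rewrite -ler_pdivrMr ?normr_gt0//; apply: ub_le_sup.
  exact: (opnorm_has_sup f).2.
exists (`|x|^-1 *: x) => /=.
  by rewrite normrZ normfV normr_id mulVf ?normr_eq0.
by rewrite linearZ normrZ normfV normr_id mulrC.
Qed.

Lemma opnorm_le (f : L) (M : R) : 0 <= M ->
  (forall x, `|f x| <= M * `|x|) -> opnorm f <= M.
Proof.
move=> M0 fM; apply: ge_sup; first exact: nonempty.
by move=> _ [x /= x1 <-]; rewrite (le_trans (fM x))// ler_piMr.
Qed.

Lemma opnorm_ge0 (f : L) : 0 <= opnorm f.
Proof.
apply: (le_trans (normr_ge0 (f 0))); apply: ub_le_sup.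
  exact: (opnorm_has_sup f).2.
by exists 0 => //=; rewrite normr0.
Qed.

Let opnormD (f g : L) : opnorm (f + g) <= opnorm f + opnorm g.
Proof.
apply: opnorm_le => [|x]; first by rewrite addr_ge0 ?opnorm_ge0.
by rewrite (le_trans (ler_normD _ _))// mulrDl lerD ?opnorm_ge.
Qed.
Let opnormZ (a : R) (f : L) : opnorm (a *: f) = `|a| * opnorm f.
Proof.
have le b (h : L) : opnorm (b *: h) <= `|b| * opnorm h.
  apply: opnorm_le => [|x]; first by rewrite mulr_ge0 ?opnorm_ge0.
  by rewrite normrZ -mulrA ler_wpM2l ?opnorm_ge.
apply/eqP; rewrite eq_le le/=.
have [->|a0] := eqVneq a 0; first by rewrite normr0 mul0r opnorm_ge0.
rewrite -ler_pdivlMl ?normr_gt0// -normfV.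
by rewrite -{1}(scale1r f) -(mulVf a0) -scalerA le.
Qed.
Let opnorm0 (f : L) : opnorm f = 0 -> f = 0.
Proof.
move=> f0; apply/val_inj/funext => x; apply/eqP; rewrite -normr_le0.
by rewrite (le_trans (opnorm_ge f x))// f0 mul0r.
Qed.

HB.instance Definition _ := Lmodule_isNormed.Build R L opnormD opnormZ opnorm0.

End blin_norm.

Section smooth.
Context (R : realType) (X : normedModType R).

(* The differential as an element of the normed space [blin X Y]; only
   meaningful where f is differentiable. *)
Definition fderiv (Y : normedModType R) (f : X -> Y) (x : X) : blin X Y :=
  insubd 0 ('d f x : X -> Y).

Fixpoint class_C (k : nat) (Y : normedModType R) (U : set X) (f : X -> Y) :
    Prop :=
  if k is k'.+1 then
    (forall x, U x -> differentiable f x) /\ class_C k' U (fderiv f)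
  else forall x, U x -> {for x, continuous f}.

(* Meant for open U; the values of f outside U are then irrelevant. *)
Definition smooth_on (Y : normedModType R) (U : set X) (f : X -> Y) : Prop :=
  forall k, class_C k U f.

End smooth.

Section manifold.
Context (R : realType).

(* [chart_inv] is only meaningful on the image of [chart_dom]. *)
Record chart (M : topologicalType) := Chart {
  chart_model : completeNormedModType R;
  chart_dom : set M;
  chart_map :> M -> chart_model;
  chart_inv : chart_model -> M }.
Arguments chart_inv {M} c _.

Definition chart_img (M : topologicalType) (c : chart M) :
  set (chart_model c) := [set c x | x in chart_dom c].
Arguments chart_img {M} c _.

Definition is_chart (M : topologicalType) (c : chart M) : Prop :=
  [/\ open (chart_dom c), open (chart_img c),
      forall x, chart_dom c x -> chart_inv c (c x) = x,
      forall x, chart_dom c x -> {for x, continuous c} &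
      forall y, chart_img c y -> {for y, continuous (chart_inv c)}].

Definition smooth_transition (M : topologicalType) (c d : chart M) : Prop :=
  smooth_on [set c x | x in chart_dom c `&` chart_dom d] (d \o chart_inv c).

Definition compatible (M : topologicalType) (c d : chart M) : Prop :=
  smooth_transition c d /\ smooth_transition d c.

(* A set of charts; [chart M] is too large a type for [set]. *)
Definition atlas (M : topologicalType) := chart M -> Prop.

Definition maximal_smooth_atlas (M : topologicalType) (A : atlas M) :
    Prop :=
  [/\ forall c, A c -> is_chart c,
      forall x, exists2 c, A c & chart_dom c x,
      forall c d, A c -> A d -> compatible c d &
      forall c, is_chart c -> (forall d, A d -> compatible c d) -> A c].

Definition banach_manifold (M : topologicalType) (A : atlas M) : Prop :=
  hausdorff_space M /\ maximal_smooth_atlas A.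

(* The maximal atlas generated by a smooth atlas B. *)
Definition atlas_of (M : topologicalType) (B : atlas M) :
    atlas M :=
  fun c => is_chart c /\ forall d, B d -> compatible c d.

Definition prod_chart (M N : topologicalType) (c : chart M) (d : chart N) :
    chart (M * N)%type :=
  @Chart (M * N)%type (chart_model c * chart_model d)%type
    (chart_dom c `*` chart_dom d) (fun z => (c z.1, d z.2))
    (fun y => (chart_inv c y.1, chart_inv d y.2)).

Definition prod_atlas (M N : topologicalType) (A : atlas M)
    (B : atlas N) : atlas (M * N)%type :=
  atlas_of (fun e => exists c d, [/\ A c, B d & e = prod_chart c d]).

Section maps.
Context (M N : topologicalType) (A : atlas M) (B : atlas N).
Implicit Type f : M -> N.

Definition local_rep (c : chart M) (d : chart N) f :
    chart_model c -> chart_model d :=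
  d \o f \o chart_inv c.
Arguments local_rep c d f _ : clear implicits.

Definition smooth_in_charts (c : chart M) (d : chart N) f : Prop :=
  (forall y, chart_dom c y -> chart_dom d (f y)) /\
  smooth_on (chart_img c) (local_rep c d f).

Definition smooth_map f : Prop :=
  forall x, exists c d,
    [/\ A c, B d, chart_dom c x & smooth_in_charts c d f].

(* The tangent map at each point is surjective and its kernel is the range of
   a continuous linear projection. *)
Definition submersion f : Prop :=
  forall x, exists c d,
    [/\ A c, B d, chart_dom c x, smooth_in_charts c d f &
        let D := 'd (local_rep c d f) (c x) in
        (forall w, exists v, D v = w) /\
        exists P : blin (chart_model c) (chart_model c),
          (forall v, P (P v) = P v) /\ (forall v, P v = v <-> D v = 0)].

End maps.
End manifold.

HB.structure Definition PreTopologicalGroup :=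
  {G of Topological G & Group G}.

Notation preTopologicalGroupType := PreTopologicalGroup.type.

HB.mixin Record PreTopologicalGroup_isTopologicalGroup G
    of PreTopologicalGroup G := {
  mulg_continuous : continuous (fun z : G * G => (z.1 * z.2)%g);
  invg_continuous : continuous (fun x : G => (x^-1)%g) }.

#[short(type="topologicalGroupType")]
HB.structure Definition TopologicalGroup :=
  {G of PreTopologicalGroup G & PreTopologicalGroup_isTopologicalGroup G}.

Section lie.
Context (R : realType) (G : preTopologicalGroupType) (AG : atlas R G).

Definition banach_lie_group : Prop :=
  [/\ banach_manifold AG,
      smooth_map (prod_atlas AG AG) AG (fun z => (z.1 * z.2)%g) &
      smooth_map AG AG (fun x => (x^-1)%g)].

Definition smooth_action (M : topologicalType) (A : atlas R M)
    (act : G * M -> M) : Prop :=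
  [/\ forall x, act (1%g, x) = x,
      forall g h x, act ((g * h)%g, x) = act (g, act (h, x)) &
      smooth_map (prod_atlas AG A) A act].

End lie.

Section amenable.
Context (R : realType) (G : topologicalGroupType).
Local Notation C := (R[i]^o).

Definition supnorm (f : G -> C) : R := sup (range (fun s => rnorm (f s))).

Definition ltrans (t : G) (f : G -> C) : G -> C := fun s => f (t * s)%g.

Definition RUCb : set (G -> C) :=
  [set f | [/\ has_ubound (range (fun s => rnorm (f s))), continuous f &
    forall s0 (e : R), 0 < e ->
      \forall s \near s0, supnorm (ltrans s f \- ltrans s0 f) < e]].

(* Only the values of mu on RUCb are constrained. As the supremum of an
   unbounded set is 0, the second condition includes the boundedness of mu. *)
Definition amenable : Prop :=
  exists mu : (G -> C) -> C,
    [/\ forall (a : R[i]) f g, RUCb f -> RUCb g ->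
          mu (a *: f + g) = a * mu f + mu g,
        sup [set rnorm (mu f) | f in RUCb `&` [set f | supnorm f <= 1]] = 1,
        mu (cst 1) = 1 &
        forall t f, RUCb f -> mu (ltrans t f) = mu f].

End amenable.

(* The ring structure is added by a separate instance: a structure joining
   [GRing.PzRing] and [NormedModule] would have to precede [Num.NumDomain]. *)
HB.mixin Record isBanachAlgebra (K : numFieldType) A
    of CompleteNormedModule K A := {
  banach_one : A;
  banach_mul : A -> A -> A;
  banach_mulA : associative banach_mul;
  banach_mul1 : left_id banach_one banach_mul;
  banach_mulr1 : right_id banach_one banach_mul;
  banach_mulDl : left_distributive banach_mul +%R;
  banach_mulDr : right_distributive banach_mul +%R;
  banach_scaleAl : forall (a : K) x y,
    a *: banach_mul x y = banach_mul (a *: x) y;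
  banach_scaleAr : forall (a : K) x y,
    a *: banach_mul x y = banach_mul x (a *: y);
  banach_normM : forall x y, `|banach_mul x y| <= `|x| * `|y| }.

#[short(type="banachAlgType")]
HB.structure Definition BanachAlgebra (K : numFieldType) :=
  {A of CompleteNormedModule K A & isBanachAlgebra K A}.

HB.instance Definition _ (K : numFieldType) (A : banachAlgType K) :=
  GRing.Zmodule_isPzRing.Build A (@banach_mulA K A) (@banach_mul1 K A)
    (@banach_mulr1 K A) (@banach_mulDl K A) (@banach_mulDr K A).

Section units.
Context (K : numFieldType) (A : banachAlgType K).

Definition invertible : set A :=
  [set a | exists b, a * b = 1 /\ b * a = 1].

Definition units : Type := set_type invertible.

Definition uval (u : units) : A := \val u.

HB.instance Definition _ := Topological.copy units (set_type invertible).

Let mkunit (a : A) (ia : invertible a) : units := exist _ a (mem_set ia).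

Let invertible1 : invertible 1.
Proof. by exists 1; rewrite mulr1. Qed.
Let one := mkunit invertible1.

Let invertibleM (u v : units) : invertible (uval u * uval v).
Proof.
have [u' [uu' u'u]] := set_mem (valP u).
have [v' [vv' v'v]] := set_mem (valP v).
exists (v' * u'); split.
  by rewrite mulrA -(mulrA _ (uval v)) vv' mulr1.
by rewrite mulrA -(mulrA v') u'u mulr1.
Qed.
Let mul u v := mkunit (invertibleM u v).

Let uinv (u : units) : A := projT1 (cid (set_mem (valP u))).
Let uinvP (u : units) : uval u * uinv u = 1 /\ uinv u * uval u = 1.
Proof. exact: projT2 (cid (set_mem (valP u))). Qed.
Let invertibleV (u : units) : invertible (uinv u).
Proof. by exists (uval u); have [] := uinvP u. Qed.
Let inv u := mkunit (invertibleV u).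

Let mulA : associative mul.
Proof. by move=> u v w; apply: val_inj; rewrite /= /uval /= mulrA. Qed.
Let mul1 : left_id one mul.
Proof. by move=> u; apply: val_inj; rewrite /= /uval /= mul1r. Qed.
Let mulr1' : right_id one mul.
Proof. by move=> u; apply: val_inj; rewrite /= /uval /= mulr1. Qed.
Let mulV : left_inverse one inv mul.
Proof. by move=> u; apply: val_inj => /=; have [] := uinvP u. Qed.
Let mulrV' : right_inverse one inv mul.
Proof. by move=> u; apply: val_inj => /=; have [] := uinvP u. Qed.

HB.instance Definition _ := isGroup.Build units mulA mul1 mulr1' mulV mulrV'.

Lemma uval1 : uval 1%g = 1. Proof. by []. Qed.
Lemma uvalM u v : uval (u * v)%g = uval u * uval v. Proof. by []. Qed.

End units.

(* The invertible elements as an open subset of the real Banach space A, with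
   the inclusion as global chart. *)
Section units_manifold.
Context (R : realType) (A : banachAlgType R[i]).

Definition units_chart : chart R (units A) :=
  @Chart R (units A) (realify A) setT (@uval _ A)
    (insubd (1%g : units A) : realify A -> units A).

Definition units_atlas : atlas R (units A) := atlas_of (eq units_chart).

End units_manifold.

Arguments units_atlas {R} A _.

Section operator_space.
Context (R : realType).
Local Notation C := R[i].

Record hilbertSpace := HilbertSpace {
  hilbert_sort :> completeNormedModType C;
  inner : hilbert_sort -> hilbert_sort -> C;
  inner_linear : forall (a : C) x y z,
    inner (a *: x + y) z = a * inner x z + inner y z;
  inner_conj : forall x y, inner y x = conjc (inner x y);
  inner_norm : forall x, inner x x = `|x| ^+ 2 }.

Section amplification.
Context (I : finType) (H : normedModType C).

Definition l2norm (x : I -> H) : R :=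
  Num.sqrt (\sum_i rnorm (x i) ^+ 2).

(* The norm of the operator matrix T acting on the Hilbert sum of copies of H
   indexed by I. *)
Definition mxopnorm (T : I -> I -> H -> H) : R :=
  sup [set l2norm (fun i => \sum_j T i j (x j)) |
       x in [set x : I -> H | l2norm x <= 1]].

End amplification.

(* The norms on the spaces of square matrices of size n.+1. *)
Definition matrix_norms (X : lmodType C) := forall n, 'M[X]_n.+1 -> R.

Definition complete_norms (X : lmodType C) (N : matrix_norms X) : Prop :=
  forall n,
  [/\ forall x y, N n (x + y) <= N n x + N n y,
      forall (a : C) x, N n (map_mx ( *:%R a) x) = complex.Re `|a| * N n x,
      forall x, N n x = 0 -> x = 0 &
      forall u : nat -> 'M[X]_n.+1,
        (forall e, 0 < e ->
          exists m, forall p q, (m <= p)%N -> (m <= q)%N ->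
            N n (u p - u q) < e) ->
        exists l, forall e, 0 < e ->
          exists m, forall p, (m <= p)%N -> N n (u p - l) < e].

Definition completely_isometric (X : lmodType C) (N : matrix_norms X)
    (H : hilbertSpace) (phi : X -> blin H H) : Prop :=
  forall n (x : 'M[X]_n.+1), mxopnorm (fun i j => phi (x i j)) = N n x.

Definition is_operator_space (X : lmodType C) (N : matrix_norms X) : Prop :=
  complete_norms N /\
  exists (H : hilbertSpace) (phi : {linear X -> blin H H}),
    completely_isometric N phi.

Record operatorSpace := OperatorSpace {
  os_sort :> lmodType C;
  os_norm : matrix_norms os_sort;
  os_axiom : is_operator_space os_norm }.

Definition homomorphism (A : banachAlgType C) (H : hilbertSpace)
    (phi : A -> blin H H) : Prop :=
  forall a b x, phi (a * b) x = phi a (phi b x).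

(* The norm of A is submultiplicative as soon as A embeds isometrically and
   multiplicatively in the bounded operators on a Hilbert space, so that
   starting from a Banach algebra is no restriction. No condition is put on the
   norm of the unit. *)
Record unitalOperatorAlgebra := UnitalOperatorAlgebra {
  oa_sort :> banachAlgType C;
  oa_norm : matrix_norms oa_sort;
  oa_space_axiom : is_operator_space oa_norm;
  oa_norm1 : forall a, oa_norm (const_mx a : 'M[oa_sort]_1) = rnorm a;
  oa_axiom : exists (H : hilbertSpace) (phi : {linear oa_sort -> blin H H}),
    homomorphism phi /\ completely_isometric oa_norm phi }.

Definition oa_space (A : unitalOperatorAlgebra) : operatorSpace :=
  OperatorSpace (oa_space_axiom A).

Section dual.
Context (X : operatorSpace).

Definition dual_space : set (X -> C) :=
  [set f | (forall (a : C) x y, f (a *: x + y) = a * f x + f y) /\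
    exists M : R, forall x,
      complex.Re `|f x| <= M * os_norm (const_mx x : 'M[X]_1)].

(* The canonical matrix norms of the dual: a matrix of functionals is normed as
   a completely bounded map from X to the scalar matrices, its m-th
   amplification being indexed by pairs. *)
Definition cbnorm n (f : 'I_n.+1 -> 'I_n.+1 -> X -> C) : R :=
  sup [set r | exists m (x : 'M[X]_m.+1), os_norm x <= 1 /\
    r = mxopnorm (fun (p q : 'I_n.+1 * 'I_m.+1) (z : C^o) =>
          f p.1 q.1 (x p.2 q.2) * z)].

(* J identifies the operator space Y with the dual of X. *)
Definition is_dual_via (Y : operatorSpace) (J : Y -> X -> C) : Prop :=
  [/\ forall (a : C) y z x, J (a *: y + z) x = a * J y x + J z x,
      range J = dual_space &
      forall n (y : 'M[Y]_n.+1), cbnorm (fun i j => J (y i j)) = os_norm y].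

Definition weakstar (Y : operatorSpace) (J : Y -> X -> C) :=
  initial_topology (J : Y -> {ptws X -> C^o}).

End dual.

Section ultraweak.
Context (H : hilbertSpace).

Definition square_summable : set (nat -> H) :=
  [set x | cvgn (series (fun k => rnorm (x k) ^+ 2))].

(* The functionals T |-> sum_k <T x_k, y_k>, for x and y square summable, are
   the trace functionals T |-> tr (T S) with S of trace class, i.e. the predual
   of the space of bounded operators. *)
Definition trace_functional (T : blin H H)
    (p : square_summable `*` square_summable) : C^o :=
  limn (series (fun k => inner (T ((\val p).1 k)) ((\val p).2 k) : C^o)).

Definition ultraweak :=
  initial_topology
    (trace_functional :
       blin H H -> {ptws (square_summable `*` square_summable) -> C^o}).

End ultraweak.

Definition dual_operator_algebra (A : unitalOperatorAlgebra) : Prop :=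
  exists (X : operatorSpace) (J : oa_space A -> X -> C),
    is_dual_via J /\
    exists (H : hilbertSpace) (phi : {linear A -> blin H H}),
      [/\ homomorphism phi, completely_isometric (@oa_norm A) phi &
          continuous (phi : weakstar J -> ultraweak H)].

End operator_space.

Section representations.
Context (R : realType) (G : topologicalGroupType) (A : banachAlgType R[i]).

Definition bounded_reps : set (G -> units A) :=
  [set rho | [/\ continuous rho,
    forall g h, rho (g * h)%g = (rho g * rho h)%g &
    has_ubound (range (fun g => rnorm (uval (rho g))))]].

Definition conj_rep (a : units A) (rho : G -> units A) : G -> units A :=
  fun g => (a * rho g * a^-1)%g.

Definition conj_orbit (rho : G -> units A) : set (G -> units A) :=
  range (fun a => conj_rep a rho).

End representations.

(* Main.v *)
Require Import Defs.
From HB Require Import structures.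
From mathcomp Require Import all_boot all_order all_algebra.
From mathcomp Require Import complex.
From mathcomp Require Import all_classical all_reals all_analysis.
From mathcomp Require Import ring lra.

(** Averaging g |-> rho(g) a rho(g)^-1 with an invariant mean gives a bounded
    map E of A onto the commutant of rho(G), with E 1 = 1 and E(ab) = E(a)b for
    b in the commutant. The average is characterized weakly, by
    <phi(E a)x, y> = mu(g |-> <phi(rho(g) a rho(g)^-1)x, y>) for a completely
    isometric representation phi. If A is a dual, the functional
    x |-> mu(g |-> J(rho(g) a rho(g)^-1)x) on the predual is J(E a); if G is
    compact, E a is a norm limit of finite sums taken along partitions of unity.
    The orbit is the quotient of the invertible elements by those of the
    commutant. Near g, an element a factors uniquely as g(1 + y)b with y in the
    kernel of E and b in the commutant, and y is the coordinate of the class of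
    a; as the kernel of E is complemented, the orbit maps are submersions. *)

Set Implicit Arguments.
Unset Strict Implicit.
Unset Printing Implicit Defensive.

Import Order.TTheory GRing.Theory Num.Theory.
Import numFieldNormedType.Exports.

Local Open Scope classical_set_scope.
Local Open Scope ring_scope.

(** An invariant mean integrates scalar functions only, and scalar averages of an A-valued function
    need not come from an element of A. The conditions on A or G serve to produce this element; the
    properties of the average are then read off its coefficients <phi(.)x, y>, which separate points
    and control the norm because phi is isometric. Left invariance makes the average b commute with
    rho(t): once phi(rho(t)) is moved across the inner product by an adjoint, the coefficient
    function of rho(t)b is the left translate by t of that of b rho(t). The Riesz representation is
    there to supply this adjoint. A closed subspace of a Banach space need not be complemented, so a
    quotient by the commutant has no evident model space; the idempotent E provides one, its kernel.
    As the orbit has the quotient topology, its Hausdorff property and the continuity of its charts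
    are checked on A. *)

(** * Bounded linear maps and derivatives as elements of [blin] *)

Section bounded_linear.
Context (R : realType).
Implicit Types X Y Z W : normedModType R.

Lemma blinDE X Y (f g : blin X Y) x : (f + g) x = f x + g x.
Proof. by []. Qed.

Lemma blinBE X Y (f g : blin X Y) x : (f - g) x = f x - g x.
Proof. by []. Qed.

Lemma blinZE X Y (a : R) (f : blin X Y) x : (a *: f) x = a *: f x.
Proof. by []. Qed.

Lemma blin0E X Y x : (0 : blin X Y) x = 0.
Proof. by []. Qed.

Lemma blin_le X Y (f : blin X Y) x : `|f x| <= `|f| * `|x|.
Proof. exact: opnorm_ge. Qed.

Lemma blin_eq X Y (f g : blin X Y) : f =1 g -> f = g.
Proof. by move=> fg; apply/val_inj/funext. Qed.

Lemma bounded_linear_blin X Y (f : X -> Y) (M : R) : linear f ->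
  (forall x, `|f x| <= M * `|x|) -> f \in @blin_pred R X Y.
Proof.
move=> lf fM; apply/asboolP; split=> // x.
pose F : {linear X -> Y} := HB.pack f (GRing.isLinear.Build R X Y *:%R f lf).
have : bounded_near F (nbhs (0 : X)).
  apply/linear_boundedP; exists M; split; first exact: num_real.
  move=> r Mr y; rewrite (le_trans (fM y))// ler_wpM2r// ltW//.
by move/linear_bounded_continuous => /(_ x).
Qed.

Definition mkblin X Y (f : X -> Y) (M : R) lf fM : blin X Y :=
  Blin (@bounded_linear_blin X Y f M lf fM).

Lemma norm_mkblin X Y f M lf fM : 0 <= M -> `|@mkblin X Y f M lf fM| <= M.
Proof. by move=> M0; apply: opnorm_le. Qed.
End bounded_linear.

Section derivative.
Context (R : realType).
Implicit Types X Y Z W : normedModType R.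

(** The differential is unique, so one epsilon estimate gives both differentiability and the value
    of [fderiv]. *)
Lemma differentiableE X Y (f : X -> Y) x (L : blin X Y) :
  (forall e : R, 0 < e ->
    \forall h \near (0 : X), `|f (h + x) - f x - L h| <= e * `|h|) ->
  differentiable f x /\ fderiv f x = L.
Proof.
move=> fL.
have H : f \o shift x = cst (f x) + (L : X -> Y) +o_ (0 : X) id.
  apply/eqaddoP => e e0; near=> h.
  rewrite /= opprD addrA; near: h; exact: fL.
have dL : 'd f x = L :> (X -> Y).
  exact: (diff_unique (@blin_continuous _ _ _ L)).
split.
  apply/diff_locallyP; split; first by rewrite dL; exact: blin_continuous.
  by rewrite dL.
by rewrite /fderiv dL; apply: val_inj; rewrite val_insubd blinP.
Unshelve. all: by end_near. Qed.

Lemma fderivE X Y (f : X -> Y) x : differentiable f x ->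
  fderiv f x = 'd f x :> (X -> Y).
Proof.
move=> df; rewrite /fderiv; transitivity (val (insubd (0 : blin X Y) ('d f x : X -> Y))) => //.
rewrite val_insubd ifT//; apply/asboolP; split; last exact: diff_continuous.
exact: linearP.
Qed.

Lemma fderiv_eq X Y (f : X -> Y) x (g : X -> Y) (L : blin X Y) :
  is_diff x f g -> L =1 g -> differentiable f x /\ fderiv f x = L.
Proof.
move=> fg Lg; split; first exact: ex_diff.
by apply: blin_eq => y; rewrite fderivE// diff_val Lg.
Qed.
End derivative.

(** * Bounded bilinear maps, as maps into spaces of bounded linear maps *)

Section blin_operations.
Context (R : realType).
Implicit Types X Y Z W : normedModType R.

Definition mkblin2 X Y Z (f : X -> Y -> Z) (M : R)
  (lf : forall x, linear (f x)) (lf' : forall y, linear (f^~ y)) (M0 : 0 <= M)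
  (fM : forall x y, `|f x y| <= M * `|x| * `|y|) : blin X (blin Y Z).
Proof.
refine (@mkblin R X (blin Y Z) (fun x => mkblin (lf x) (fM x)) M _ _).
- abstract by move=> a x x'; apply: blin_eq => y; exact: (lf' y a x x').
- abstract by move=> x; apply: norm_mkblin; exact: mulr_ge0.
Defined.

Let comp_lin X Y Z (g : blin Y Z) (f : blin X Y) : linear (g \o f).
Proof. by move=> a x y /=; rewrite !linearP. Qed.
Let comp_bound X Y Z (g : blin Y Z) (f : blin X Y) x :
  `|g (f x)| <= `|g| * `|f| * `|x|.
Proof.
by rewrite (le_trans (blin_le _ _))// -mulrA ler_wpM2l// blin_le.
Qed.

Definition bcomp X Y Z (g : blin Y Z) (f : blin X Y) : blin X Z :=
  mkblin (comp_lin g f) (comp_bound g f).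

Lemma norm_bcomp X Y Z (g : blin Y Z) (f : blin X Y) :
  `|bcomp g f| <= `|g| * `|f|.
Proof. by apply: norm_mkblin; rewrite mulr_ge0. Qed.

(** With composition as a bounded bilinear map, the chain rule writes the derivative of a composite
    as a bilinear expression in derivatives, which can be differentiated again. *)
Definition compL X Y Z : blin (blin Y Z) (blin (blin X Y) (blin X Z)).
Proof.
refine (@mkblin2 (blin Y Z) (blin X Y) (blin X Z) (@bcomp X Y Z) 1 _ _ _ _).
- abstract by move=> g a f f'; apply: blin_eq => x; rewrite /= linearP.
- abstract by move=> f a g g'; apply: blin_eq.
- abstract exact: ler01.
- abstract by move=> g f; rewrite mul1r norm_bcomp.
Defined.

Lemma blin2_le X Y Z (B : blin X (blin Y Z)) x y :
  `|B x y| <= `|B| * `|x| * `|y|.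
Proof.
by rewrite (le_trans (blin_le _ _))// ler_wpM2r// blin_le.
Qed.

Definition bflip X Y Z (B : blin X (blin Y Z)) : blin Y (blin X Z).
Proof.
refine (@mkblin2 Y X Z (fun y x => B x y) `|B| _ _ _ _).
- abstract by move=> y a x x'; rewrite linearP.
- abstract by move=> x a y y'; rewrite linearP.
- abstract by [].
- abstract by move=> y x; rewrite mulrAC blin2_le.
Defined.

Lemma norm_bflip X Y Z (B : blin X (blin Y Z)) : `|bflip B| <= `|B|.
Proof. exact: norm_mkblin. Qed.

(** In the product rule, v |-> B(f'(x)v)(g(x)) takes its variable v before the argument g(x); the
    exchange exhibits it as a bounded bilinear function of f'(x) and g(x). *)
Definition flipL X Y Z : blin (blin X (blin Y Z)) (blin Y (blin X Z)).
Proof.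
refine (@mkblin R (blin X (blin Y Z)) (blin Y (blin X Z)) (@bflip X Y Z) 1 _ _).
- abstract by (move=> a f g; do 2!(apply: blin_eq => ?);
    rewrite /= ?blinDE ?blinZE).
- abstract by move=> f; rewrite mul1r norm_bflip.
Defined.

Definition bid X : blin X X.
Proof.
refine (@mkblin R X X id 1 _ _); first by [].
by move=> x; rewrite mul1r.
Defined.

Definition pairL X Y Z : blin (blin X Y * blin X Z)%type (blin X (Y * Z)%type).
Proof.
refine (@mkblin2 (blin X Y * blin X Z)%type X (Y * Z)%type
  (fun p x => (p.1 x, p.2 x)) 1 _ _ _ _).
- abstract by move=> p a x y; rewrite !linearP.
- abstract by (move=> x a p q; congr pair; rewrite /= ?blinDE ?blinZE).
- abstract exact: ler01.
- abstract by (move=> p x; rewrite mul1r {1}prod_normE ge_max/=;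
    rewrite !(le_trans (blin_le _ _))// ler_wpM2r// prod_normE le_max lexx ?orbT).
Defined.

Definition bfst X Y : blin (X * Y)%type X.
Proof.
refine (@mkblin R (X * Y)%type X fst 1 _ _); first by [].
abstract by (move=> x; rewrite mul1r prod_normE le_max lexx).
Defined.

Definition bsnd X Y : blin (X * Y)%type Y.
Proof.
refine (@mkblin R (X * Y)%type Y snd 1 _ _); first by [].
abstract by (move=> x; rewrite mul1r prod_normE le_max lexx orbT).
Defined.
End blin_operations.

(** * Calculus of maps of class C^k *)

Section class_C.
Context (R : realType).
Implicit Types X Y Z W : normedModType R.

(** [fderiv] is the derivative in the whole space, whatever U is, so class C^k on U is a condition
    at each point of U; restriction and gluing follow at once. *)
Lemma class_C_point X Y k (U : set X) (f : X -> Y) :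
  class_C k U f <-> forall x, U x -> class_C k [set x] f.
Proof.
elim: k Y f => [|k IH] Y f /=.
  split=> [H x Ux _ ->|H x Ux]; [exact: H|exact: (H x)].
split=> [[df /IH cf] x Ux|H]; first by split=> [_ ->|]; [exact: df|exact: cf].
split=> [x Ux|]; first by have [+ _] := H x Ux; apply.
by apply/IH => x Ux; have [] := H x Ux.
Qed.

Lemma class_C_subset X Y k (U V : set X) (f : X -> Y) : V `<=` U ->
  class_C k U f -> class_C k V f.
Proof.
by move=> VU /class_C_point H; apply/class_C_point => x Vx; apply: H; exact: VU.
Qed.

Lemma class_C_cover X Y k (U : set X) (f : X -> Y) :
  (forall x, U x -> exists2 V : set X, V x & class_C k V f) -> class_C k U f.
Proof.
move=> H; apply/class_C_point => x /H[V Vx /class_C_point]; exact.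
Qed.

Lemma near_fderiv X Y (x : X) (f g : X -> Y) :
  (\forall y \near x, f y = g y) -> differentiable f x ->
  differentiable g x /\ fderiv g x = fderiv f x.
Proof.
move=> fg df; apply: differentiableE => e e0.
have /diff_locallyP[_ /eqaddoP/(_ e e0) H] := df.
have fgx : f x = g x by exact: nbhs_singleton fg.
have fg0 : \forall h \near (0 : X), f (h + x) = g (h + x).
  move: fg; rewrite (near_shift 0); apply: filterS => y /=.
  by rewrite subr0.
near=> h; rewrite fderivE// -fgx -(near fg0 h)//.
rewrite -addrA -opprD; near: h; exact: H.
Unshelve. all: by end_near. Qed.

Lemma near_is_diff X Y (x : X) (f g df : X -> Y) :
  (\forall y \near x, f y = g y) -> is_diff x f df -> 'd g x =1 df.
Proof.
move=> fg [fx dE] v; have [gx gE] := near_fderiv fg fx.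
by rewrite -(fderivE gx) gE (fderivE fx) dE.
Qed.

(** Openness of U makes f and g agree near each of its points, so their derivatives agree on U and
    the induction continues. This lets a formula replace a function whose values outside U are
    arbitrary. *)
Lemma class_C_eq X Y k (U : set X) (f g : X -> Y) : open U ->
  (forall x, U x -> f x = g x) -> class_C k U f -> class_C k U g.
Proof.
move=> oU; elim: k Y f g => [|k IH] Y f g fg /=.
  move=> cf x Ux; rewrite /prop_for /continuous_at -(fg x Ux).
  apply: (cvg_trans _ (cf x Ux)).
  apply: near_eq_cvg; near=> y; apply/fg.
  by near: y; exact: open_nbhs_nbhs.
have nfg x : U x -> \forall y \near x, f y = g y.
  move=> Ux; near=> y; apply/fg.
  by near: y; exact: open_nbhs_nbhs.
move=> [df cf]; split=> [x Ux|].
  exact: (near_fderiv (nfg x Ux) (df x Ux)).1.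
apply: IH cf => x Ux.
exact: esym (near_fderiv (nfg x Ux) (df x Ux)).2.
Unshelve. all: by end_near. Qed.

Lemma class_CS X Y k (U : set X) (f : X -> Y) :
  class_C k.+1 U f -> class_C k U f.
Proof.
elim: k Y f => [|k IH] Y f /= [df cf].
  by move=> x Ux; apply: differentiable_continuous; exact: df.
by split=> //; exact: IH.
Qed.

Lemma class_C_cont X Y k (U : set X) (f : X -> Y) : class_C k U f ->
  forall x, U x -> {for x, continuous f}.
Proof. by elim: k => // k IH /class_CS. Qed.

Lemma class_C_cst X Y k (U : set X) (c : Y) : class_C k U (cst c : X -> Y).
Proof.
elim: k Y c => [|k IH] Y c /=; first by move=> x _; exact: cst_continuous.
split=> [x _|]; first exact: differentiable_cst.
have -> : fderiv (cst c : X -> Y) = cst 0; last exact: IH.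
by apply/funext => x; have [] := fderiv_eq (is_diff_cst c x) (fun=> blin0E _ _).
Qed.

Lemma class_C_id X k (U : set X) : class_C k U (@id X).
Proof.
case: k => [|k] /=; first by move=> x _; exact: cvg_id.
split=> [x _|]; first exact: ex_diff.
have -> : fderiv (@id X) = cst (bid X); last exact: class_C_cst.
by apply/funext => x; have [] := @fderiv_eq _ _ _ id x id (bid X) (is_diff_id _) (fun=> erefl).
Qed.

Lemma is_diff_blin X Y (L : blin X Y) x : is_diff x L L.
Proof.
apply: DiffDef; first exact/linear_differentiable/blin_continuous.
exact/diff_lin/blin_continuous.
Qed.

(** As for the closure properties below, the derivative is an expression of the same kind between
    other spaces, here with [compL] applied to L; the induction on k therefore generalizes over the
    spaces. *)
Lemma class_C_blin X Y Z k (U : set X) (L : blin Y Z) (f : X -> Y) : open U ->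
  class_C k U f -> class_C k U (L \o f).
Proof.
move=> oU; elim: k Y Z L f => [|k IH] Y Z L f /=.
  move=> cf x Ux; apply: continuous_comp; first exact: cf.
  exact: blin_continuous.
move=> [df cf].
have H x : U x -> differentiable (L \o f) x /\
    fderiv (L \o f) x = bcomp L (fderiv f x).
  move=> Ux; apply: (@fderiv_eq _ _ _ _ _ (L \o 'd f x)).
    apply: is_diff_comp; first exact: DiffDef (df x Ux) erefl.
    exact: is_diff_blin.
  by move=> v /=; rewrite fderivE//; exact: df.
split=> [x /H[]//|].
apply: (@class_C_eq _ _ _ _ (compL X Y Z L \o fderiv f)) => //.
  by move=> x /H[_ ->].
exact: IH.
Qed.

Lemma class_C_pair X Y Z k (U : set X) (f : X -> Y) (g : X -> Z) : open U ->
  class_C k U f -> class_C k U g -> class_C k U (fun x => (f x, g x)).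
Proof.
move=> oU; elim: k Y Z f g => [|k IH] Y Z f g /=.
  by move=> cf cg x Ux; apply: cvg_pair; [exact: cf|exact: cg].
move=> [df cf] [dg cg].
have H x : U x -> differentiable (fun x => (f x, g x)) x /\
    fderiv (fun x => (f x, g x)) x = pairL _ _ _ (fderiv f x, fderiv g x).
  move=> Ux; apply: (@fderiv_eq _ _ _ _ _ (fun v => ('d f x v, 'd g x v))).
    by apply: is_diff_pair; apply: DiffDef; [exact: df| |exact: dg|].
  by move=> v /=; rewrite -!fderivE//; [exact: dg|exact: df].
split=> [x /H[]//|].
apply: (@class_C_eq _ _ _ _ (pairL X Y Z \o (fun x => (fderiv f x, fderiv g x)))) => //.
  by move=> x /H[_ ->].
apply: class_C_blin => //; exact: IH.
Qed.

Lemma class_CD X Y k (U : set X) (f g : X -> Y) : open U ->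
  class_C k U f -> class_C k U g -> class_C k U (fun x => f x + g x).
Proof.
move=> oU; elim: k Y f g => [|k IH] Y f g /=.
  by move=> cf cg x Ux; apply: cvgD; [exact: cf|exact: cg].
move=> [df cf] [dg cg].
have H x : U x -> differentiable (fun x => f x + g x) x /\
    fderiv (fun x => f x + g x) x = fderiv f x + fderiv g x.
  move=> Ux; apply: (@fderiv_eq _ _ _ _ _ (fun v => 'd f x v + 'd g x v)).
    by apply: is_diffD; apply: DiffDef; [exact: df| |exact: dg|].
  by move=> v; rewrite blinDE -!fderivE//; [exact: dg|exact: df].
split=> [x /H[]//|].
apply: (@class_C_eq _ _ _ _ (fun x => fderiv f x + fderiv g x)) => //.
  by move=> x /H[_ ->].
exact: IH.
Qed.

Lemma bilinear_continuous X Y Z (B : blin X (blin Y Z)) :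
  continuous (fun p : X * Y => B p.1 p.2).
Proof.
move=> [x y]; apply/cvgrPdist_lt => e e0 /=.
have B1 : 0 < `|B| + 1 by rewrite ltr_wpDl.
have y1 : 0 < `|x| + `|y| + 1 by rewrite ltr_wpDl// addr_ge0.
(* The bound d <= 1 gives |p.1| <= |x| + 1, the quotient makes |B| d (|x| + |y| + 1) < e, and the
   added ones keep the divisors positive. *)
pose d := Num.min 1 (e / ((`|B| + 1) * (`|x| + `|y| + 1))).
have d0 : 0 < d by rewrite lt_min ltr01 divr_gt0// mulr_gt0.
near=> p.
have : ball (x, y) d p by near: p; apply: (nbhsx_ballx (x, y) d).
move=> [] /=; rewrite -!ball_normE /= => px py.
have -> : B x y - B p.1 p.2 = B (x - p.1) y + B p.1 (y - p.2).
  by rewrite [B (x - _)]linearB blinBE linearB addrA subrK.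
have p1 : `|p.1| <= `|x| + 1.
  rewrite -lerBlDl; apply: le_trans (lerB_dist _ _) _.
  by rewrite distrC (le_trans (ltW px))// ge_min lexx.
rewrite (le_lt_trans (ler_normD _ _))//.
rewrite (@le_lt_trans _ _ (`|B| * d * `|y| + `|B| * (`|x| + 1) * d))//.
  apply: lerD; rewrite (le_trans (blin2_le _ _ _))//.
    by rewrite ler_wpM2r// ler_wpM2l// ltW.
  apply: ler_pM => //; last exact: ltW.
  by rewrite ler_wpM2l.
have -> : `|B| * d * `|y| + `|B| * (`|x| + 1) * d = d * (`|B| * (`|x| + `|y| + 1)).
  by ring.
rewrite (@lt_le_trans _ _ (d * ((`|B| + 1) * (`|x| + `|y| + 1))))//.
  by rewrite ltr_pM2l// ltr_pM2r// ltrDl.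
rewrite -ler_pdivlMr; first by rewrite ge_min lexx orbT.
by rewrite mulr_gt0.
Unshelve. all: by end_near. Qed.

Lemma bilinear_diff X Y Z (B : blin X (blin Y Z)) p :
  is_diff p (fun p : X * Y => B p.1 p.2) (fun q => B p.1 q.2 + B q.1 p.2).
Proof.
have bil : bilinear_for (GRing.Scale.Law.clone _ _ ( *:%R ) _)
   (GRing.Scale.Law.clone _ _ ( *:%R ) _) (fun x y => B x y).
  split=> [y|x] a u v; last by rewrite linearP.
  by rewrite linearP.
pose F : {bilinear X -> Y -> Z} := HB.pack (fun x y => B x y) (bilinear_isBilinear.Build _ _ _ _ _ _ _ bil).
apply: DiffDef; first exact: (@differentiable_bilin _ _ _ _ F) (@bilinear_continuous _ _ _ B).
exact: (@diff_bilin _ _ _ _ F) (@bilinear_continuous _ _ _ B).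
Qed.

Lemma class_C_bilin X Y1 Y2 Z k (U : set X) (B : blin Y1 (blin Y2 Z))
  (f : X -> Y1) (g : X -> Y2) : open U ->
  class_C k U f -> class_C k U g -> class_C k U (fun x => B (f x) (g x)).
Proof.
move=> oU; elim: k Y1 Y2 Z B f g => [|k IH] Y1 Y2 Z B f g.
  move=> /= cf cg x Ux.
  apply: (@continuous_comp _ _ _ (fun x => (f x, g x)) (fun p => B p.1 p.2)).
    by apply: cvg_pair; [exact: cf|exact: cg].
  exact: bilinear_continuous.
move=> Cf Cg; have [df cf] := Cf; have [dg cg] := Cg.
(* The bounded bilinear maps giving the two terms of the product rule, v |-> B(f(x))(g'(x)v) and v
   |-> B(f'(x)v)(g(x)). *)
pose B1 := bcomp (compL X Y2 Z) B.
pose B2 := bcomp (flipL X Y2 Z) (compL X Y1 (blin Y2 Z) B).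
have H x : U x -> differentiable (fun x => B (f x) (g x)) x /\
    fderiv (fun x => B (f x) (g x)) x =
    B1 (f x) (fderiv g x) + B2 (fderiv f x) (g x).
  move=> Ux; have dfg := class_C_pair oU.
  have dp : is_diff x (fun x => (f x, g x)) (fun v => ('d f x v, 'd g x v)).
    by apply: is_diff_pair; apply: DiffDef; [exact: df| |exact: dg|].
  apply: (fderiv_eq (@is_diff_comp _ _ _ _ _ _ _ _ _ dp (bilinear_diff B _))).
  by have := df x Ux; have := dg x Ux; move=> dgx dfx v; rewrite blinDE /= !fderivE.
split=> [x /H[]//|].
apply: (@class_C_eq _ _ _ _ (fun x => B1 (f x) (fderiv g x) + B2 (fderiv f x) (g x))) => //.
  by move=> x /H[_ ->].
by apply: class_CD => //; apply: IH => //; exact: class_CS.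
Qed.

(** By the chain rule the derivative is the bilinear map [compL] applied to [fderiv g \o f], of
    class C^k by induction, and to [fderiv f]. *)
Lemma class_C_comp X Y Z k (U : set X) (V : set Y) (f : X -> Y) (g : Y -> Z) :
  open U -> (forall x, U x -> V (f x)) ->
  class_C k U f -> class_C k V g -> class_C k U (g \o f).
Proof.
move=> oU UV; elim: k Z g => [|k IH] Z g.
  move=> /= cf cg x Ux; apply: continuous_comp; first exact: cf.
  by apply: cg; exact: UV.
move=> Cf [dg cg]; have [df cf] := Cf.
have H x : U x -> differentiable (g \o f) x /\
    fderiv (g \o f) x = compL X Y Z (fderiv g (f x)) (fderiv f x).
  move=> Ux; apply: (@fderiv_eq _ _ _ _ _ ('d g (f x) \o 'd f x)).
    by apply: is_diff_comp; apply: DiffDef; [exact: df| |exact/dg/UV|].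
  by have := dg _ (UV _ Ux); have := df x Ux => dfx dgx v /=; rewrite !fderivE.
split=> [x /H[]//|].
apply: (@class_C_eq _ _ _ _ (fun x => compL X Y Z ((fderiv g \o f) x) (fderiv f x))) => //.
  by move=> x /H[_ ->].
by apply: class_C_bilin => //; apply: IH => //; exact: class_CS.
Qed.
End class_C.

(** * Charts, the atlas they generate, and products *)

Arguments chart_inv {R M} c _.
Arguments chart_img {R M} c _.

Section charts.
Context (R : realType).
Implicit Types M N : topologicalType.

Lemma chart_imgK M (c : chart R M) y : is_chart c -> chart_img c y ->
  c (chart_inv c y) = y.
Proof. by move=> [_ _ cK _ _] [x cx <-]; rewrite cK. Qed.

(** Near c(x) every point lies in the image, and continuity of the inverse keeps its preimage in
    O. *)
Lemma chart_image_open M (c : chart R M) (O : set M) : is_chart c -> open O ->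
  open [set c x | x in chart_dom c `&` O].
Proof.
move=> cc oO; have [oc oi cK _ ci] := cc.
rewrite openE => _ [x [cx Ox] <-]; rewrite /interior.
have icx : chart_img c (c x) by exists x.
have H : \forall y \near c x, chart_img c y by exact: open_nbhs_nbhs.
have H2 : \forall y \near c x, (chart_dom c `&` O) (chart_inv c y).
  apply: (ci _ icx); rewrite cK//.
  by apply: open_nbhs_nbhs; split=> //; exact: openI.
near=> y.
have iy : chart_img c y by near: y.
by exists (chart_inv c y); [near: y|exact: chart_imgK].
Unshelve. all: by end_near. Qed.

Lemma chart_preimage_open M (c : chart R M) (V : set (chart_model c)) :
  is_chart c -> open V -> open (chart_dom c `&` c @^-1` V).
Proof.
move=> [oc _ _ ccont _] oV; rewrite openE => x [cx Vx].
have nc : nbhs x (chart_dom c) by exact: open_nbhs_nbhs.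
have nV : nbhs (c x) V by exact: open_nbhs_nbhs.
exact: (filterI nc (ccont x cx _ nV)).
Qed.

Lemma smooth_transition_refl M (c : chart R M) : is_chart c ->
  smooth_transition c c.
Proof.
move=> cc; have [oc oi cK _ ci] := cc.
move=> k; apply: (@class_C_eq _ _ _ _ _ id).
- by apply: chart_image_open.
- by move=> _ [x [cx _] <-] /=; rewrite cK.
- exact: class_C_id.
Qed.

(** Compatibility is not transitive: the detour through b gives smoothness only where all three
    domains meet. *)
Lemma smooth_transition_trans M (c b d : chart R M) :
  is_chart c -> is_chart b -> is_chart d ->
  smooth_transition c b -> smooth_transition b d ->
  smooth_on [set c x | x in chart_dom c `&` (chart_dom b `&` chart_dom d)]
    (d \o chart_inv c).
Proof.
move=> cc cb cd cbs bds k; have [oc oi cK _ ci] := cc.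
have [ob _ bK _ _] := cb; have [od _ _ _ _] := cd.
set U := (X in class_C _ X _).
have oU : open U by apply: chart_image_open => //; exact: openI.
apply: (@class_C_eq _ _ _ _ _ ((d \o chart_inv b) \o (b \o chart_inv c))) => //.
  by move=> _ [x [cx [bx dx]] <-] /=; rewrite cK// bK.
apply: class_C_comp (bds k) => //.
  by move=> _ [x [cx [bx dx]] <-] /=; rewrite cK//; exists x.
apply: class_C_subset (cbs k).
by move=> _ [x [cx [bx dx]] <-]; exists x.
Qed.

Section atlas_of.
Context M (B : atlas R M).
Hypothesis Bchart : forall c, B c -> is_chart c.
Hypothesis Bcover : forall x, exists2 c, B c & chart_dom c x.
Hypothesis Bcompat : forall c d, B c -> B d -> compatible c d.

Lemma sub_atlas_of c : B c -> atlas_of B c.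
Proof. by move=> Bc; split; [exact: Bchart|move=> d; exact: Bcompat]. Qed.

(** Charts of [atlas_of B] are by definition compatible with B only. Smoothness being local, a chart
    of B around each point of the overlap makes them compatible with each other. *)
Lemma atlas_of_transition c d : atlas_of B c -> atlas_of B d ->
  smooth_transition c d.
Proof.
move=> [cc cB] [cd dB] k; apply: class_C_cover => _ [x [cx dx] <-].
have [b Bb bx] := Bcover x.
exists [set c y | y in chart_dom c `&` (chart_dom b `&` chart_dom d)].
  by exists x.
apply: smooth_transition_trans => //; first exact: Bchart.
  by have [] := cB b Bb.
by have [] := dB b Bb.
Qed.

Lemma atlas_of_compatible c d : atlas_of B c -> atlas_of B d -> compatible c d.
Proof. by move=> Bc Bd; split; exact: atlas_of_transition. Qed.

Lemma atlas_of_maximal : maximal_smooth_atlas (atlas_of B).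
Proof.
split.
- by move=> c [].
- by move=> x; have [c Bc cx] := Bcover x; exists c => //; exact: sub_atlas_of.
- exact: atlas_of_compatible.
- by move=> c cc H; split=> // d Bd; apply: H; exact: sub_atlas_of.
Qed.
End atlas_of.

(** [smooth_in_charts] asks that the whole chart domain be mapped into the target domain, so charts
    have to be shrunk around a point. *)
Definition restrict_chart M (c : chart R M) (O : set M) : chart R M :=
  @Chart R M (chart_model c) (chart_dom c `&` O) c (chart_inv c).

Lemma restrict_is_chart M (c : chart R M) O : is_chart c -> open O ->
  is_chart (restrict_chart c O).
Proof.
move=> cc oO; have [oc oi cK ccont ci] := cc; split => /=.
- exact: openI.
- exact: chart_image_open.
- by move=> x [cx _]; exact: cK.
- by move=> x [cx _]; exact: ccont.
- by move=> _ [x [cx _] <-]; apply: ci; exists x.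
Qed.

Lemma restrict_atlas_of M (B : atlas R M) c O : atlas_of B c -> open O ->
  atlas_of B (restrict_chart c O).
Proof.
move=> [cc cB] oO; split; first exact: restrict_is_chart.
move=> d /cB[cd dc]; split=> k.
  by apply: class_C_subset (cd k) => _ [x [[cx Ox] dx] <-]; exists x.
by apply: class_C_subset (dc k) => _ [x [dx [cx Ox]] <-]; exists x.
Qed.

Lemma smooth_map_atlas_of M N (B : atlas R M) (A : atlas R N) (f : M -> N) :
  (forall x, exists c d, [/\ atlas_of B c, A d, chart_dom c x &
    exists O : set M, [/\ open O, O x,
      (forall y, chart_dom c y -> O y -> chart_dom d (f y)) &
      smooth_on [set c y | y in chart_dom c `&` O]
        (d \o f \o chart_inv c)]]) ->
  smooth_map (atlas_of B) A f.
Proof.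
move=> H x; have [c [d [Bc Ad cx [ O [oO Ox Od fs]]]]] := H x.
exists (restrict_chart c O), d; split=> //; first exact: restrict_atlas_of.
by split=> //= y [cy Oy]; exact: Od.
Qed.

Lemma class_C_fst k (X Y : normedModType R) (U : set (X * Y)%type) : open U ->
  class_C k U (fst : _ -> X).
Proof. by move=> oU; exact: (class_C_blin (bfst X Y) oU (class_C_id k U)). Qed.

Lemma class_C_snd k (X Y : normedModType R) (U : set (X * Y)%type) : open U ->
  class_C k U (snd : _ -> Y).
Proof. by move=> oU; exact: (class_C_blin (bsnd X Y) oU (class_C_id k U)). Qed.

Lemma open_setX (S T : topologicalType) (U : set S) (V : set T) :
  open U -> open V -> open (U `*` V).
Proof.
move=> oU oV; rewrite openE => -[x y] [Ux Vy].
by exists (U, V) => //; split; exact: open_nbhs_nbhs.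
Qed.

Lemma prod_is_chart M N (c : chart R M) (d : chart R N) : is_chart c ->
  is_chart d -> is_chart (prod_chart c d).
Proof.
move=> [oc oi cK cc ci] [od odi dK dc di].
have imgE : chart_img (prod_chart c d) = chart_img c `*` chart_img d.
  apply/seteqP; split=> [_ [[x y] [/= cx dy] <-]|[a b] [/= [x cx <-] [y dy <-]]].
    by split; [exists x|exists y].
  by exists (x, y).
split.
- exact: open_setX.
- by rewrite imgE; exact: open_setX.
- by move=> [x y] [/= cx dy]; rewrite /= cK// dK.
- move=> [x y] [/= cx dy]; apply: cvg_pair => /=.
    by apply: (@continuous_comp _ _ _ (@fst M N) c (x, y)); [exact: cvg_fst|exact: cc].
  by apply: (@continuous_comp _ _ _ (@snd M N) d (x, y)); [exact: cvg_snd|exact: dc].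
- rewrite imgE => -[x y] [/= cx dy]; apply: cvg_pair => /=.
    by apply: (@continuous_comp _ _ _ (@fst (chart_model c) (chart_model d)) (chart_inv c) (x, y)); [exact: cvg_fst|exact: ci].
  by apply: (@continuous_comp _ _ _ (@snd (chart_model c) (chart_model d)) (chart_inv d) (x, y)); [exact: cvg_snd|exact: di].
Qed.

Lemma prod_smooth_transition M N (c c' : chart R M) (d d' : chart R N) :
  is_chart c -> is_chart c' -> is_chart d -> is_chart d' ->
  smooth_transition c c' -> smooth_transition d d' ->
  smooth_transition (prod_chart c d) (prod_chart c' d').
Proof.
move=> cc cc' cd cd' tc td k; rewrite /smooth_transition.
set U := (X in class_C _ X _).
have oU : open U.
  apply: chart_image_open; first exact: prod_is_chart.
  by have [] := prod_is_chart cc' cd'.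
have HU1 z : U z -> [set c x | x in chart_dom c `&` chart_dom c'] z.1.
  by move=> [[x y] [/= [cx dy] [c'x d'y]] <-]; exists x.
have HU2 z : U z -> [set d x | x in chart_dom d `&` chart_dom d'] z.2.
  by move=> [[x y] [/= [cx dy] [c'x d'y]] <-]; exists y.
apply: (@class_C_pair _ _ _ _ _ _ (fun z => c' (chart_inv c z.1))
  (fun z => d' (chart_inv d z.2))) => //.
  by apply: (class_C_comp oU HU1 (class_C_fst _ oU) (tc k)).
by apply: (class_C_comp oU HU2 (class_C_snd _ oU) (td k)).
Qed.

Lemma prod_atlas_prod_chart M N (A : atlas R M) (B : atlas R N) c d :
  maximal_smooth_atlas A -> maximal_smooth_atlas B -> A c -> B d ->
  prod_atlas A B (prod_chart c d).
Proof.
move=> [Ac _ Acomp _] [Bc _ Bcomp _] Acc Bcd; split.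
  by apply: prod_is_chart; [exact: Ac|exact: Bc].
move=> _ [c' [d' [Ac' Bd' ->]]].
have [cc' c'c] := Acomp _ _ Acc Ac'; have [dd' d'd] := Bcomp _ _ Bcd Bd'.
by split; apply: prod_smooth_transition => //; by [exact: Ac|exact: Bc].
Qed.
End charts.

(** * The real-valued norm of a complex normed space *)

Section real_norm.
Context (R : realType).
Local Notation C := R[i].

Lemma realify_normE (X : completeNormedModType C) (x : realify X) :
  `|x| = rnorm (x : X).
Proof. by []. Qed.

Lemma rnorm_ge0 (X : normedModType C) (x : X) : 0 <= rnorm x.
Proof. by rewrite -lecR rnormE; exact: normr_ge0. Qed.

Lemma rnorm_eq0 (X : normedModType C) (x : X) : (rnorm x == 0) = (x == 0).
Proof.
apply/idP/idP => [/eqP x0|/eqP->]; last by rewrite /rnorm normr0.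
by rewrite -(normr_eq0 x) -rnormE x0.
Qed.

Lemma rnorm0 (X : normedModType C) : rnorm (0 : X) = 0.
Proof. by apply/eqP; rewrite rnorm_eq0. Qed.

Lemma rnormD (X : normedModType C) (x y : X) :
  rnorm (x + y) <= rnorm x + rnorm y.
Proof. by rewrite -lecR rmorphD/= !rnormE ler_normD. Qed.

Lemma rnormN (X : normedModType C) (x : X) : rnorm (- x) = rnorm x.
Proof. by rewrite /rnorm normrN. Qed.

Lemma rnormB (X : normedModType C) (x y : X) : rnorm (x - y) = rnorm (y - x).
Proof. by rewrite -rnormN opprB. Qed.

Lemma rnormZ (X : normedModType C) (a : C) (x : X) :
  rnorm (a *: x) = rnorm (a : C^o) * rnorm x.
Proof. by apply: (@complexI R); rewrite rmorphM/= !rnormE normrZ. Qed.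

Lemma rnorm_normc (a : R) : rnorm (a%:C%C : C^o) = `|a|.
Proof. by rewrite /rnorm normc_def/= expr0n/= addr0 sqrtr_sqr. Qed.

Lemma rnorm_scalarM (a b : C^o) : rnorm (a * b : C^o) = rnorm a * rnorm b.
Proof. exact: rnormZ. Qed.

Lemma rnorm_sum (X : normedModType C) (I : Type) (r : seq I) (P : pred I)
    (F : I -> X) :
  rnorm (\sum_(i <- r | P i) F i) <= \sum_(i <- r | P i) rnorm (F i).
Proof.
elim/big_ind2 : _ => [|x a y b xa yb|//]; first by rewrite rnorm0.
by rewrite (le_trans (rnormD _ _))// lerD.
Qed.
End real_norm.

(** * Smoothness of inversion in a Banach algebra *)

Section banach_algebra.
Context (R : realType) (A : banachAlgType R[i]).
Local Notation X := (realify A).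

Lemma rnormM (x y : A) : rnorm (x * y) <= rnorm x * rnorm y.
Proof. by rewrite -lecR rmorphM/= !rnormE banach_normM. Qed.

Lemma scaler_mulAl (a : R[i]) (x y : A) : a *: (x * y) = (a *: x) * y.
Proof. exact: banach_scaleAl. Qed.

Lemma scaler_mulAr (a : R[i]) (x y : A) : a *: (x * y) = x * (a *: y).
Proof. exact: banach_scaleAr. Qed.

Definition amul : blin X (blin X X).
Proof.
refine (@mkblin2 R X X X (fun x y => (x : A) * (y : A)) 1 _ _ _ _).
- abstract by (move=> x a y z; rewrite mulrDr -scaler_mulAr).
- abstract by (move=> y a x z; rewrite mulrDl -scaler_mulAl).
- abstract exact: ler01.
- abstract by (move=> x y; rewrite mul1r rnormM).
Defined.

Lemma affine_fixpoint (L : blin X X) (c : X) : `|L| < 1 ->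
  exists x, x = c + L x.
Proof.
move=> L1.
have fU : set_fun [set: X] [set: X] (fun x => c + L x) by [].
pose f : {fun [set: X] >-> [set: X]} :=
  HB.pack (fun x : X => c + L x) (isFun.Build _ _ _ _ _ fU).
have cf : is_contraction f.
  exists (NngNum (normr_ge0 L)); split=> //= -[x y] _ /=.
  by rewrite opprD addrACA subrr add0r -linearB blin_le.
have [||x _ xE] := banach_fixed_point cf; first exact: closedT.
  by exists 0.
by exists x.
Qed.

(** The contractions x |-> 1 - ux and y |-> 1 - yu have fixed points, in place of a Neumann series;
    these are a right and a left inverse, hence equal. *)
Lemma rnorm_lt1_invertible (u : A) : rnorm u < 1 -> invertible (1 + u).
Proof.
move=> u1.
have [x xE] : exists x : X, x = (1 : A) + amul (- u) x.
  apply: affine_fixpoint; apply: le_lt_trans u1.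
  apply: opnorm_le => [|y]; first exact: rnorm_ge0.
  by rewrite -rnormN; exact: rnormM.
have [y yE] : exists y : X, y = (1 : A) + bflip amul (- u) y.
  apply: affine_fixpoint; apply: le_lt_trans u1.
  apply: opnorm_le => [|y]; first exact: rnorm_ge0.
  by rewrite mulrC -rnormN; exact: rnormM.
have rx : (1 + u) * x = 1.
  by rewrite mulrDl mul1r [X in X + _]xE/= mulNr subrK.
have ly : y * (1 + u) = 1.
  by rewrite mulrDr mulr1 [X in X + _]yE/= mulrN subrK.
exists x; split=> //; rewrite -[RHS]ly; congr (_ * _).
by rewrite -[LHS]mul1r -ly -mulrA rx mulr1.
Qed.

(** Made total by the value 0 off the invertible elements; these form an open set, so smoothness
    there does not see it. *)
Definition ainv (a : X) : X :=
  if pselect (invertible (a : A)) is left ia then projT1 (cid ia) else 0.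

Lemma ainvP (a : A) : invertible a -> a * ainv a = 1 /\ ainv a * a = 1.
Proof. by rewrite /ainv; case: pselect => // ia _; case: cid. Qed.

Lemma mulrI_inv (a b : A) : a * b = 1 -> b * a = 1 -> ainv a = b.
Proof.
move=> ab ba; have ia : invertible a by exists b.
have [aV Va] := ainvP ia.
by rewrite -[LHS]mulr1 -ab mulrA Va mul1r.
Qed.

Lemma invertibleMl (a b : A) : invertible a -> invertible b ->
  invertible (a * b).
Proof.
move=> /ainvP[aV Va] /ainvP[bV Vb].
exists ((ainv b : A) * (ainv a : A)); split.
  by rewrite mulrA -(mulrA a) bV mulr1.
by rewrite mulrA -(mulrA (ainv b : A)) Va mulr1.
Qed.

(** a + h = a(1 + bh) and c - b = -chb, for b the inverse of a and c that of a + h. *)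
Lemma ainv_near (a : A) : invertible a ->
  exists2 d : R, 0 < d & forall h : A, rnorm h < d ->
  invertible (a + h) /\
  rnorm (ainv (a + h) - ainv a) <= 2 * rnorm (ainv a : A) ^+ 2 * rnorm h.
Proof.
move=> ia; have [aV Va] := ainvP ia; set b : A := ainv a.
(* This radius makes |b||h| <= 1/2, so that |c - b| <= |c|/2 and |c| <= 2|b|. The added 1 avoids a
   zero divisor, as b = 0 when A is trivial. *)
exists (2^-1 / (rnorm b + 1)) => [|h].
  by rewrite divr_gt0// ltr_wpDl// rnorm_ge0.
have b0 := rnorm_ge0 b; have h0 := rnorm_ge0 h.
rewrite ltr_pdivlMr ?ltr_wpDl// => hb.
have hb2 : rnorm b * rnorm h <= 2^-1.
  by rewrite mulrC (le_trans _ (ltW hb))// ler_wpM2l// lerDl.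
have iah : invertible (a + h).
  have -> : a + h = a * (1 + b * h) by rewrite mulrDr mulr1 mulrA aV mul1r.
  apply: invertibleMl => //; apply: rnorm_lt1_invertible.
  rewrite (le_lt_trans (rnormM _ _))// (le_lt_trans hb2)//.
  by rewrite invf_lt1// ltr1n.
split=> //; have [cV Vc] := ainvP iah; set c : A := ainv (a + h).
have cb : c - b = - (c * h * b).
  have -> : c * h = 1 - c * a by rewrite -Vc mulrDr addrAC subrr add0r.
  by rewrite mulrBl mul1r -mulrA aV mulr1 opprB.
have c0 := rnorm_ge0 c.
have cb1 : rnorm (c - b) <= rnorm c * (rnorm b * rnorm h).
  rewrite cb rnormN (le_trans (rnormM _ _))// [rnorm b * _]mulrC mulrA.
  by rewrite ler_wpM2r// rnormM.
have c2 : rnorm c <= 2 * rnorm b.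
  have : rnorm c <= rnorm (c - b) + rnorm b.
    by rewrite -{1}(subrK b c) rnormD.
  have : rnorm (c - b) <= rnorm c * 2^-1.
    by rewrite (le_trans cb1)// ler_wpM2l.
  by lra.
rewrite (le_trans cb1)// expr2 !mulrA ler_wpM2r// ler_wpM2r//.
Qed.

Lemma open_invertible : open (@invertible _ A : set X).
Proof.
rewrite openE => a /ainv_near[d d0 H]; apply/nbhs_ballP; exists d => //= y.
rewrite -ball_normE/= distrC => yd.
by have [+ _] := H _ yd; rewrite addrC subrK.
Qed.

(** The derivative is v |-> -bvb with b the inverse of a. As c - b = -chb, the error is -(c - b)hb,
    of norm at most 2|b|^3|h|^2. *)
Lemma ainv_diff (a : X) : invertible (a : A) ->
  differentiable ainv a /\
  fderiv ainv a = compL X X X (- amul (ainv a)) (bflip amul (ainv a)).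
Proof.
move=> ia; have [d d0 H] := ainv_near ia.
have [aV Va] := ainvP ia; set b : A := ainv a.
apply: differentiableE => e e0.
have b0 := rnorm_ge0 b.
have K0 : 0 < 2 * rnorm b ^+ 3 + 1 by rewrite ltr_wpDl// mulr_ge0// exprn_ge0.
near=> h.
have hd : rnorm (h : A) < d.
  near: h; apply/nbhs_ballP; exists d => //= y.
  by rewrite -ball_normE/= sub0r normrN.
have he : rnorm (h : A) < e / (2 * rnorm b ^+ 3 + 1).
  near: h; apply/nbhs_ballP; exists (e / (2 * rnorm b ^+ 3 + 1)) => /=.
    exact: divr_gt0.
  by move=> y; rewrite -ball_normE/= sub0r normrN.
have [iah Hh] := H _ hd; rewrite [h + a]addrC.
have [cV Vc] := ainvP iah; set c : A := ainv (a + h) in cV Vc Hh *.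
have cb : c - b = - (c * h * b) :> A.
  have -> : c * h = 1 - c * a by rewrite -Vc mulrDr addrAC subrr add0r.
  by rewrite mulrBl mul1r -mulrA aV mulr1 opprB.
have E : c - b - (- (b * (h * b))) = - ((c - b) * h * b) :> A.
  by rewrite opprK {1}cb !mulrBl opprB addrC mulrA.
rewrite realify_normE -[_ - _ - _]/(c - b - (- (b * (h * b))) : A) E rnormN.
rewrite (le_trans (rnormM _ _))//.
rewrite (le_trans (ler_wpM2r b0 (rnormM _ _)))//.
rewrite realify_normE mulrAC ler_wpM2r ?rnorm_ge0//.
rewrite (le_trans (ler_wpM2r b0 Hh))//.
rewrite ltr_pdivlMr// in he.
have h0 := rnorm_ge0 (h : A).
rewrite (le_trans _ (ltW he))// mulrDr mulr1 -[leLHS]addr0 lerD//.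
by rewrite exprS [leLHS](_ : _ = rnorm (h : A) * (2 * (rnorm b * rnorm b ^+ 2)))//; ring.
Unshelve. all: by end_near. Qed.

(** The derivative of inversion is bilinear in inversion itself, so smoothness bootstraps. *)
Lemma class_C_ainv k (U : set X) : open U -> U `<=` @invertible _ A ->
  class_C k U ainv.
Proof.
move=> oU UI; elim: k => [|k IH] /=.
  by move=> x Ux; apply: (@differentiable_continuous R X X); exact: (ainv_diff (UI _ Ux)).1.
split=> [x Ux|]; first exact: (ainv_diff (UI _ Ux)).1.
apply: (@class_C_eq _ _ _ _ _
  (fun x => compL X X X (- amul (ainv x)) (bflip amul (ainv x)))) => //.
  by move=> x /UI Ux; have [] := ainv_diff Ux.
apply: class_C_bilin => //; last exact: class_C_blin.
have E : (- amul) \o ainv =1 (fun x => - amul (ainv x)) by [].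
by rewrite -(funext E); exact: class_C_blin.
Qed.
End banach_algebra.

(** * The Banach-Lie group of invertible elements *)

Lemma separated_hausdorff (I : Type) (M T : topologicalType) (f : I -> M -> T) :
  hausdorff_space T -> (forall i, continuous (f i)) ->
  (forall p q, (forall i, f i p = f i q) -> p = q) -> hausdorff_space M.
Proof.
move=> hT fc fI p q pq; apply: fI => i; apply: hT => U V Up Vq.
have [x [Ux Vx]] := pq _ _ (fc i p _ Up) (fc i q _ Vq).
by exists (f i x).
Qed.

Section units_lie.
Context (R : realType) (A : banachAlgType R[i]).
Local Notation X := (realify A).
Local Notation uc := (units_chart A).

Definition to_unit (a : X) : units A := insubd (1%g : units A) a.

Lemma to_unitK (a : X) : invertible (a : A) -> uval (to_unit a) = a.
Proof. by move=> ia; rewrite /uval /to_unit val_insubd mem_set. Qed.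

Lemma uvalK (u : units A) : to_unit (uval u) = u.
Proof. by rewrite /to_unit /uval valKd. Qed.

Lemma uval_inj : injective (@uval _ A).
Proof. exact: val_inj. Qed.

Lemma uvalP (u : units A) : invertible (uval u).
Proof. exact: set_mem (valP u). Qed.

Lemma uvalV (u : units A) : uval (u^-1)%g = ainv (uval u).
Proof.
by apply/esym/mulrI_inv; rewrite -uvalM ?mulgV ?mulVg uval1.
Qed.

Lemma uval_continuous : continuous (@uval _ A : units A -> X).
Proof. exact: initial_continuous. Qed.

Lemma units_continuous_at (T : topologicalType) (f : T -> units A) (x : T) :
  {for x, continuous (fun y => uval (f y) : X)} -> {for x, continuous f}.
Proof.
move=> cf W; rewrite {1}nbhsE => -[V [[W0 oW WV] Vx] VW].
have : nbhs x (fun y => W0 (uval (f y))).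
  apply: cf; apply: open_nbhs_nbhs; split=> //.
  by move: Vx; rewrite -WV.
by apply: filterS => y Wy; apply: VW; rewrite -WV.
Qed.

Lemma units_hausdorff : hausdorff_space (units A).
Proof.
apply: (@separated_hausdorff unit (units A) X (fun=> @uval _ A)).
- exact: norm_hausdorff.
- by move=> _; exact: uval_continuous.
- by move=> p q /(_ tt) /uval_inj.
Qed.

Lemma units_chart_img : chart_img uc = @invertible _ A.
Proof.
apply/seteqP; split=> [_ [u _ <-]|a ia]; first exact: uvalP.
by exists (to_unit a) => //; exact: to_unitK.
Qed.

Lemma units_is_chart : is_chart uc.
Proof.
split.
- exact: openT.
- by rewrite units_chart_img; exact: open_invertible.
- by move=> u _; exact: uvalK.
- by move=> u _; exact: uval_continuous.
- rewrite units_chart_img => a ia; apply: units_continuous_at.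
  have aE : (fun b : X => uval (to_unit b) : X) a = a by rewrite to_unitK.
  rewrite /prop_for /continuous_at [X in _ --> X]aE.
  apply: (@cvg_trans _ (id @ a)); last exact: cvg_id.
  apply: near_eq_cvg; near=> b; rewrite to_unitK//.
  by near: b; apply: open_nbhs_nbhs; split=> //; exact: open_invertible.
Unshelve. all: by end_near. Qed.

Let Bchart c : units_chart A = c -> is_chart c.
Proof. by move=> <-; exact: units_is_chart. Qed.
Let Bcover (x : units A) : exists2 c, units_chart A = c & chart_dom c x.
Proof. by exists uc. Qed.
Let Bcompat c d : units_chart A = c -> units_chart A = d -> compatible c d.
Proof.
by move=> <- <-; split; apply: smooth_transition_refl; exact: units_is_chart.
Qed.

Lemma units_atlas_maximal : maximal_smooth_atlas (units_atlas A).
Proof. exact: atlas_of_maximal. Qed.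

Lemma units_atlas_chart : units_atlas A uc.
Proof. exact: sub_atlas_of. Qed.

Lemma units_prod_chart (N : topologicalType) (B : atlas R N) d :
  maximal_smooth_atlas B -> B d ->
  prod_atlas (units_atlas A) B (prod_chart uc d).
Proof.
move=> mB Bd; apply: prod_atlas_prod_chart => //.
  exact: units_atlas_maximal.
exact: units_atlas_chart.
Qed.

Lemma banach_lie_group_units : banach_lie_group (units_atlas A).
Proof.
split.
- by split; [exact: units_hausdorff|exact: units_atlas_maximal].
- apply: smooth_map_atlas_of => z; exists (prod_chart uc uc), uc; split=> //.
  + exact: (units_prod_chart units_atlas_maximal units_atlas_chart).
  + exact: units_atlas_chart.
  exists setT; split=> //; first exact: openT.
  move=> k; set U := (X in class_C _ X _).
  have oU : open U.
    apply: chart_image_open; last exact: openT.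
    by apply: prod_is_chart; exact: units_is_chart.
  apply: (@class_C_eq _ _ _ _ _ (fun z => amul A z.1 z.2)) => //.
    move=> _ [[u v] _ <-].
    by rewrite -[RHS]/(uval (to_unit (uval u) * to_unit (uval v))%g) !uvalK.
  apply: (class_C_bilin (amul A) oU); first exact: class_C_fst.
  exact: class_C_snd.
- apply: smooth_map_atlas_of => z; exists uc, uc; split=> //.
  + exact: units_atlas_chart.
  + exact: units_atlas_chart.
  exists setT; split=> //; first exact: openT.
  move=> k; set U := (X in class_C _ X _).
  have oU : open U.
    by apply: chart_image_open; [exact: units_is_chart|exact: openT].
  apply: (@class_C_eq _ _ _ _ _ (@ainv _ A)) => //.
    move=> _ [u _ <-].
    by rewrite -[RHS]/(uval (to_unit (uval u))^-1%g) uvalK uvalV.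
  apply: class_C_ainv => // _ [u _ <-]; exact: uvalP.
Qed.
End units_lie.

(** * The kernel of a bounded operator as a Banach space *)

Section kernel.
Context (R : realType) (X : completeNormedModType R) (P : blin X X).

Definition kernel_pred : {pred X} := [pred x | P x == 0].

(** The model space of the orbit; it is complete because the kernel of a continuous map is
    closed. *)
Record kernel := Kernel { kval : X; kvalP : kval \in kernel_pred }.

HB.instance Definition _ := [isSub for kval].
HB.instance Definition _ := [Choice of kernel by <:].

Let kernel_submod : submod_closed kernel_pred.
Proof.
split; first by rewrite inE linear0.
move=> a x y; rewrite !inE => /eqP Px /eqP Py.
by rewrite linearP /= Px Py scaler0 addr0.
Qed.

HB.instance Definition _ := GRing.isSubmodClosed.Build R X kernel_pred
  kernel_submod.
HB.instance Definition _ := [SubChoice_isSubLmodule of kernel by <:].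

Let knorm (x : kernel) : R := `|kval x|.

Let knormD x y : knorm (x + y) <= knorm x + knorm y.
Proof. exact: ler_normD. Qed.
Let knormZ a x : knorm (a *: x) = `|a| * knorm x.
Proof. exact: normrZ. Qed.
Let knorm0 x : knorm x = 0 -> x = 0.
Proof. by move=> /normr0_eq0 x0; apply: val_inj. Qed.

HB.instance Definition _ := Lmodule_isNormed.Build R kernel knormD knormZ knorm0.

Lemma kernel_normE (x : kernel) : `|x| = `|kval x|.
Proof. by []. Qed.

Lemma kval0 (x : kernel) : P (kval x) = 0.
Proof. exact/eqP/(kvalP x). Qed.

Lemma kval_inj : injective kval.
Proof. exact: val_inj. Qed.

Definition kvalL : blin kernel X.
Proof.
refine (@mkblin R kernel X kval 1 _ _); first by [].
by move=> x; rewrite mul1r.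
Defined.

Lemma kernel_closed (F : set_system X) (x : X) : ProperFilter F ->
  F --> x -> F (fun y => P y = 0) -> P x = 0.
Proof.
move=> FF Fx F0; apply/eqP; rewrite -normr_le0; apply/ler_addgt0Pr => e e0.
rewrite add0r.
have : F (fun y => `|P x - P y| < e).
  have /cvgrPdist_lt : P @ F --> P x.
    by apply: (cvg_trans (cvg_app P Fx)); exact: blin_continuous.
  exact.
move=> /(filterI F0)/filter_ex[y [Py]].
by rewrite Py subr0 => /ltW.
Qed.

Let kernel_complete (F : set_system kernel) :
  ProperFilter F -> cauchy F -> cvg F.
Proof.
move=> FF cF; have cF' := (cauchyP F).1 cF.
have cX : cauchy (kval @ F).
  apply: cauchy_exP => e /cF'[x xF]; exists (kval x).
  apply: (@filterS _ F _ (ball x e)) xF => y.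
  by rewrite -!ball_normE.
have xl : cvg (kval @ F) by exact: cauchy_cvg.
set l : X := lim (kval @ F) in xl.
have Pl : P l = 0.
  apply: (@kernel_closed (kval @ F) l _ xl).
  by apply: (@filterE _ F _) => y; exact: kval0.
have lk : l \in kernel_pred by rewrite inE Pl.
apply/cvg_ex; exists (Kernel lk); apply/cvgrPdist_lt => e e0.
by have /cvgrPdist_lt/(_ e e0) := xl.
Qed.

HB.instance Definition _ := Uniform_isComplete.Build kernel kernel_complete.

Section projection.
Hypothesis PP : forall x, P (P x) = P x.

Let to_kernel_subproof x : x - P x \in kernel_pred.
Proof. by rewrite inE linearB /= PP subrr. Qed.

Definition to_kernel x : kernel := Kernel (to_kernel_subproof x).

Lemma to_kernelE x : kval (to_kernel x) = x - P x.
Proof. by []. Qed.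

Definition to_kernelL : blin X kernel.
Proof.
refine (@mkblin R X kernel to_kernel (1 + `|P|) _ _).
- abstract by (move=> a x y; apply: kval_inj; rewrite /= linearP /= scalerBr opprD addrACA).
- abstract by (move=> x; rewrite kernel_normE to_kernelE mulrDl mul1r
    (le_trans (ler_normB _ _))// lerD2l blin_le).
Defined.

End projection.

End kernel.

(** * The orbit as a topological quotient *)

Section orbit.
Context (R : realType) (A : banachAlgType R[i]) (G : topologicalGroupType).
Context (rho : G -> units A).
Local Notation X := (realify A).

(* Carries the quotient topology of [units A]. *)
Definition orbit : Type := set_type (conj_orbit rho).

HB.instance Definition _ := gen_eqMixin orbit.
HB.instance Definition _ := gen_choiceMixin orbit.

Let conj_orbitP (a : units A) : conj_orbit rho (conj_rep a rho).
Proof. by exists a. Qed.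

Definition orbit_pi (a : units A) : orbit :=
  exist _ (conj_rep a rho) (mem_set (conj_orbitP a)).

Definition orbit_val (p : orbit) : G -> units A := sval p.

Lemma orbit_val_inj : injective orbit_val.
Proof. by move=> [p pP] [q qP] /= pq; apply: eq_exist. Qed.

Lemma range_orbit_val : range orbit_val = conj_orbit rho.
Proof.
apply/seteqP; split=> [_ [[p pP] _ <-]|p pP]; first exact: set_mem pP.
by exists (exist _ p (mem_set pP)).
Qed.

Lemma orbit_pi_surj p : exists a, orbit_pi a = p.
Proof.
have [a _ aE] := set_mem (svalP p).
by exists a; apply: orbit_val_inj.
Qed.

Definition orbit_repr (p : orbit) : units A := projT1 (cid (orbit_pi_surj p)).

Lemma orbit_reprK p : orbit_pi (orbit_repr p) = p.
Proof. exact: (projT2 (cid (orbit_pi_surj p))). Qed.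

Definition orbit_open (U : set orbit) : Prop := open (orbit_pi @^-1` U).

Let orbit_openT : orbit_open setT.
Proof. exact: openT. Qed.
Let orbit_openI : setI_closed orbit_open.
Proof. by move=> U V oU oV; exact: openI. Qed.
Let orbit_open_bigU (I : Type) (f : I -> set orbit) :
  (forall i, orbit_open (f i)) -> orbit_open (\bigcup_i f i).
Proof. by move=> fo; rewrite /orbit_open preimage_bigcup; apply: bigcup_open => i _; exact: fo. Qed.

HB.instance Definition _ :=
  isOpenTopological.Build orbit orbit_openT orbit_openI orbit_open_bigU.

Lemma orbit_openE (U : set orbit) : open U = open (orbit_pi @^-1` U).
Proof. by []. Qed.

Lemma orbit_pi_continuous : continuous orbit_pi.
Proof. by apply/continuousP => U; rewrite orbit_openE. Qed.

(** Universal property of the quotient topology in local form, since a chart is meaningful on its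
    domain only; as D is open, the part in D of the preimage of an open set is open in the
    quotient. *)
Lemma orbit_continuous_on (T : topologicalType) (f : orbit -> T)
    (D : set orbit) : open D ->
  (forall a, D (orbit_pi a) -> {for a, continuous (f \o orbit_pi)}) ->
  forall p, D p -> {for p, continuous f}.
Proof.
move=> oD fc p Dp W; rewrite {1}nbhsE => -[V [oV Vp] VW].
exists (D `&` f @^-1` V); split; [|by split|by move=> q [_ /VW]].
rewrite -[isOpenTopological.op _ _]/(open (orbit_pi @^-1` (D `&` f @^-1` V))).
rewrite openE => a [Da Va].
have nV : nbhs (f (orbit_pi a)) V by exact: open_nbhs_nbhs.
have nD : nbhs a (orbit_pi @^-1` D) by exact: open_nbhs_nbhs.
exact: (filterI nD (fc a Da _ nV)).
Qed.

Definition commutes_with_rep (b : A) := forall g, uval (rho g) * b = b * uval (rho g).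

Lemma orbit_pi_eq (a b : units A) :
  orbit_pi a = orbit_pi b <-> commutes_with_rep (uval (a^-1 * b)%g).
Proof.
split=> [/(congr1 orbit_val)/funeqP ab g|ab].
  have abg : (a * rho g * a^-1 = b * rho g * b^-1)%g := ab g.
  rewrite -!uvalM; congr uval.
  have -> : (rho g * (a^-1 * b) = a^-1 * (a * rho g * a^-1) * b)%g.
    by rewrite !mulgA mulVg mul1g.
  by rewrite abg !mulgA mulgVK.
apply/orbit_val_inj/funext => g.
have abg : (rho g * (a^-1 * b) = a^-1 * b * rho g)%g by apply: val_inj; exact: ab.
rewrite -[LHS]/(a * rho g * a^-1)%g -[RHS]/(b * rho g * b^-1)%g.
have -> : (a * rho g * a^-1 = a * (rho g * (a^-1 * b)) * b^-1)%g.
  by rewrite !mulgA mulgK.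
by rewrite abg !mulgA mulgV mul1g.
Qed.

(** Evaluations at the elements of G separate points, and they are continuous on the quotient
    because a |-> a rho(g) a^-1 is continuous in norm. *)
Lemma orbit_hausdorff : hausdorff_space orbit.
Proof.
apply: (@separated_hausdorff G orbit X (fun g p => uval (orbit_val p g))).
- exact: norm_hausdorff.
- move=> g p; apply: (@orbit_continuous_on X _ setT openT) => // a _.
  have E : (fun p => uval (orbit_val p g) : X) \o orbit_pi =
      (fun a : units A => amul A (amul A (uval a) (uval (rho g))) (ainv (uval a))).
    by apply/funext => b; rewrite -uvalV.
  rewrite E.
  have cu := @uval_continuous R A a.
  have cv : {for a, continuous (fun a : units A => ainv (uval a) : X)}.
    apply: (@continuous_comp _ _ _ (@uval _ A : units A -> X) (@ainv R A)) => //.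
    apply: (class_C_cont (class_C_ainv 0 (@open_invertible R A) _)) => //.
    exact: uvalP.
  apply: (@continuous_comp _ _ _
    (fun a : units A => (amul A (uval a : X) (uval (rho g) : X), ainv (uval a)) : X * X)
    (fun p : X * X => amul A p.1 p.2)).
    have cm : {for a, continuous (fun a : units A => amul A (uval a) (uval (rho g)))}.
      apply: (@continuous_comp _ _ _ (@uval _ A : units A -> X)
        (bflip (amul A) (uval (rho g))) a cu).
      exact: blin_continuous.
    exact: (cvg_pair cm cv).
  exact: (bilinear_continuous (B := amul A)).
- by move=> p q pq; apply/orbit_val_inj/funext => g; apply: uval_inj; exact: pq.
Qed.

Definition orbit_act (z : units A * orbit) : orbit :=
  orbit_pi (z.1 * orbit_repr z.2)%g.

Lemma orbit_valM (a b : units A) :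
  orbit_val (orbit_pi (a * b)%g) = conj_rep a (orbit_val (orbit_pi b)).
Proof.
by apply/funext => g; rewrite /orbit_val/= /conj_rep invgM !mulgA.
Qed.

Lemma orbit_val_act a p : orbit_val (orbit_act (a, p)) = conj_rep a (orbit_val p).
Proof. by rewrite /orbit_act orbit_valM orbit_reprK. Qed.

Lemma orbit_act_pi a b : orbit_act (a, orbit_pi b) = orbit_pi (a * b)%g.
Proof. by apply: orbit_val_inj; rewrite orbit_val_act -orbit_valM. Qed.

Lemma orbit_act1 p : orbit_act (1%g, p) = p.
Proof.
have [b <-] := orbit_pi_surj p. rewrite orbit_act_pi mul1g; exact: erefl.
Qed.

Lemma orbit_actM a b p : orbit_act ((a * b)%g, p) = orbit_act (a, orbit_act (b, p)).
Proof.
have [c <-] := orbit_pi_surj p; rewrite [orbit_act (b, _)]orbit_act_pi !orbit_act_pi mulgA; exact: erefl.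
Qed.
End orbit.

(** * Slices, the atlas of the orbit, and the smooth action *)

Section orbit_manifold.
Context (R : realType) (A : banachAlgType R[i]) (G : topologicalGroupType).
Context (rho : G -> units A).
Local Notation X := (realify A).
Local Notation pi := (@orbit_pi R A G rho).
Local Notation comm := (@commutes_with_rep R A G rho).
Context (E : blin X X).
Hypothesis E_comm : forall a, comm (E a).
Hypothesis E_mulr : forall a b : A, comm b -> E (a * b) = (E a : A) * b.
Hypothesis E1 : E (1 : A) = (1 : A).

Lemma expectation_id (b : A) : comm b -> E b = b.
Proof. by move=> cb; rewrite -[in LHS](mul1r b) E_mulr// E1 mul1r. Qed.

Lemma expectationK (a : X) : E (E a) = E a.
Proof. exact: expectation_id. Qed.

Lemma comm_ainv (b : A) : comm b -> invertible b -> comm (ainv b).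
Proof.
move=> cb ib g; have [bV Vb] := ainvP ib.
rewrite -[LHS]mul1r -Vb -mulrA; congr (_ * _).
by rewrite mulrA -cb -mulrA bV mulr1.
Qed.

Local Notation N := (kernel E).

(* [slice_inv g y] = g(1 + y), and [slice_map g a] is the y in the kernel of E
   for which a lies in g(1 + y) times the commutant. *)
Definition slice_translate (g : units A) : blin X X := amul A (uval g^-1%g).

(** If a = g(1 + y)b with E(y) = 0 and b an invertible element of the commutant, then E(g^-1 a) =
    E(1 + y)b = b. So b is forced to be E(g^-1 a), and the factorization needs this element to be
    invertible. *)
Definition slice_dom (g : units A) : set X :=
  [set a | invertible (E (slice_translate g a) : A)].

Definition slice_map (g : units A) (a : X) : N :=
  to_kernelL expectationK
    (amul A (slice_translate g a) (ainv (E (slice_translate g a)))).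

Definition slice_inv (g : units A) (y : N) : X :=
  amul A (uval g) ((1 : A) + kval y).

Lemma slice_dom_open g : open (slice_dom g).
Proof.
have -> : slice_dom g = (E \o slice_translate g) @^-1` (@invertible _ A) by [].
apply: open_comp; last exact: open_invertible.
move=> x _; apply: continuous_comp; exact: blin_continuous.
Qed.

(** [slice_map] applies the projection x - E(x) in order to have values in the kernel for every a;
    on the domain, E sends the product to 1, because E(xb) = E(x)b. *)
Lemma slice_mapE g (a : A) : slice_dom g a ->
  kval (slice_map g a) = (slice_translate g a : A) * ainv (E (slice_translate g a)) - 1.
Proof.
move=> ga; set m : A := (slice_translate g a : A) * ainv (E (slice_translate g a)).
rewrite -[LHS]/(m - E m); congr (_ - _); rewrite /m.
rewrite E_mulr; last exact: comm_ainv (E_comm _) ga.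
by have [] := ainvP ga.
Qed.

(** From E(g^-1 ab) = E(g^-1 a)b the factor b cancels, so the coordinate is constant on the fibres
    of [orbit_pi]. *)
Lemma slice_mapMr g (a b : A) : slice_dom g a -> comm b -> invertible b ->
  slice_dom g (a * b) /\ slice_map g (a * b) = slice_map g a.
Proof.
move=> ga cb ib.
have tE : slice_translate g (a * b) = (slice_translate g a : A) * b :> A.
  by rewrite /slice_translate /= mulrA.
have EE : E (slice_translate g (a * b)) = (E (slice_translate g a) : A) * b :> A.
  by rewrite tE E_mulr.
have gab : slice_dom g (a * b).
  by rewrite /slice_dom /= EE; exact: invertibleMl.
split=> //; apply: kval_inj; rewrite !slice_mapE// EE tE; congr (_ - _).
have [cV Vc] := ainvP ga; have [bV Vb] := ainvP ib.
set c : A := E (slice_translate g a) in cV Vc *.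
have -> : ainv (c * b) = (ainv b : A) * ainv c :> A.
  apply: mulrI_inv; first by rewrite mulrA -(mulrA c) bV mulr1.
  by rewrite mulrA -(mulrA (ainv b : A)) Vc mulr1.
by rewrite mulrA -(mulrA (slice_translate g a : A)) bV mulr1.
Qed.

Lemma slice_dom_self g : slice_dom g (uval g).
Proof.
by rewrite /slice_dom /= -uvalM mulVg uval1 E1; exists 1; rewrite mulr1.
Qed.

Lemma slice_inv_dom g y : slice_dom g (slice_inv g y).
Proof.
rewrite /slice_dom /= mulrA -uvalM mulVg uval1 mul1r linearD /= kval0 addr0 E1.
by exists 1; rewrite mulr1.
Qed.

Lemma slice_invK g y : slice_map g (slice_inv g y) = y.
Proof.
apply: kval_inj; rewrite slice_mapE; last exact: slice_inv_dom.
have tE : slice_translate g (slice_inv g y) = (1 : A) + kval y.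
  by rewrite /slice_inv /= mulrA -uvalM mulVg uval1 mul1r.
rewrite tE linearD /= kval0 addr0 E1.
have -> : ainv (1 : A) = 1 by apply: mulrI_inv; rewrite mulr1.
by rewrite mulr1 addrC addKr.
Qed.

(** The point of the slice in the fibre of a differs from a by an invertible element of the
    commutant: the class of a is recovered, not a itself. *)
Lemma slice_mapK g (a : A) : slice_dom g a ->
  slice_inv g (slice_map g a) = a * ainv (E (slice_translate g a)).
Proof.
move=> ga; rewrite /slice_inv slice_mapE//= addrC subrK mulrA.
by rewrite [uval g * _]mulrA -uvalM mulgV uval1 mul1r.
Qed.

Lemma class_C_slice_map k g (U : set X) : open U -> U `<=` slice_dom g ->
  class_C k U (slice_map g).
Proof.
move=> oU Ug; apply: (class_C_blin (to_kernelL expectationK) oU).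
have cm : class_C k U (slice_translate g).
  exact: (class_C_blin (slice_translate g) oU (class_C_id k U)).
apply: (class_C_bilin (amul A) oU) => //.
apply: (@class_C_comp R X X X k U (@invertible _ A) (E \o slice_translate g)
  (@ainv R A)) => //.
  exact: (class_C_blin E oU cm).
by apply: class_C_ainv => //; exact: open_invertible.
Qed.

Lemma class_C_slice_inv k g (U : set N) : open U -> class_C k U (slice_inv g).
Proof.
move=> oU; apply: (class_C_blin (amul A (uval g)) oU).
apply: (class_CD oU (class_C_cst _ _ _)).
exact: (class_C_blin (kvalL E) oU (class_C_id k U)).
Qed.

(** Evaluated on the chosen representative; by [slice_mapMr] any other one gives the same domain and
    coordinates. *)
Definition orbit_chart (g : units A) : chart R (orbit rho) :=
  @Chart R (orbit rho) N
    [set p | slice_dom g (uval (orbit_repr p))]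
    (fun p => slice_map g (uval (orbit_repr p)))
    (fun y => pi (to_unit (slice_inv g y))).

Lemma orbit_reprE a : exists b : A, [/\ comm b, invertible b &
  uval a = uval (orbit_repr (pi a)) * b].
Proof.
have /orbit_pi_eq ab := orbit_reprK (pi a).
exists (uval ((orbit_repr (pi a))^-1 * a)%g); split=> //; first exact: uvalP.
by rewrite -uvalM mulgA mulgV mul1g.
Qed.

Lemma orbit_reprE' a : exists b : A, [/\ comm b, invertible b &
  uval (orbit_repr (pi a)) = uval a * b].
Proof.
have /esym/orbit_pi_eq ab := orbit_reprK (pi a).
exists (uval (a^-1 * orbit_repr (pi a))%g); split=> //; first exact: uvalP.
by rewrite -uvalM mulgA mulgV mul1g.
Qed.

Lemma orbit_chart_domE g a : chart_dom (orbit_chart g) (pi a) <-> slice_dom g (uval a).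
Proof.
split=> /= ga.
  by have [b [cb ib ->]] := orbit_reprE a; have [] := slice_mapMr ga cb ib.
by have [b [cb ib ->]] := orbit_reprE' a; have [] := slice_mapMr ga cb ib.
Qed.

Lemma orbit_chartE g a : slice_dom g (uval a) ->
  orbit_chart g (pi a) = slice_map g (uval a).
Proof.
move=> ga; have [b [cb ib ab]] := orbit_reprE' a.
by rewrite /= ab; have [] := slice_mapMr ga cb ib.
Qed.

Lemma slice_map_invertible g (a : units A) : slice_dom g (uval a) ->
  invertible (slice_inv g (slice_map g (uval a)) : A).
Proof.
move=> ga; rewrite slice_mapK//; apply: invertibleMl; first exact: uvalP.
by exists (E (slice_translate g (uval a))); have [] := ainvP ga.
Qed.

Lemma orbit_chartK g a : slice_dom g (uval a) ->
  pi (to_unit (slice_inv g (slice_map g (uval a)))) = pi a.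
Proof.
move=> ga; apply/esym/orbit_pi_eq.
have -> : uval (a^-1 * to_unit (slice_inv g (slice_map g (uval a))))%g =
    ainv (E (slice_translate g (uval a))) :> A.
  rewrite uvalM to_unitK; last exact: slice_map_invertible.
  by rewrite slice_mapK// mulrA -uvalM mulVg uval1 mul1r.
exact: comm_ainv (E_comm _) ga.
Qed.

(** Every g(1 + y) lies in [slice_dom g], as E(1 + y) = 1; the restriction on y is that g(1 + y) be
    invertible, an open condition. *)
Lemma orbit_chart_img g : chart_img (orbit_chart g) =
  [set y | invertible (slice_inv g y : A)].
Proof.
apply/seteqP; split=> [_ [p gp <-]|y iy].
  exact: slice_map_invertible.
have yd : slice_dom g (uval (to_unit (slice_inv g y))).
  by rewrite to_unitK//; exact: slice_inv_dom.
exists (pi (to_unit (slice_inv g y))); first exact/orbit_chart_domE.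
by rewrite orbit_chartE// to_unitK// slice_invK.
Qed.

Lemma slice_inv_continuous g : continuous (slice_inv g).
Proof.
move=> y; apply: (class_C_cont (class_C_slice_inv 0 g openT)) => //.
Qed.

Lemma to_unit_continuous (a : A) : invertible a ->
  {for (a : X), continuous (@to_unit R A)}.
Proof.
move=> ia; have [_ _ _ _ ci] := units_is_chart A.
by apply: ci; rewrite units_chart_img.
Qed.

Lemma orbit_chart_dom_open g : open (chart_dom (orbit_chart g)).
Proof.
rewrite orbit_openE.
have -> : pi @^-1` (chart_dom (orbit_chart g)) = @uval _ A @^-1` slice_dom g.
  by apply/seteqP; split=> a /orbit_chart_domE.
apply: open_comp; last exact: slice_dom_open.
by move=> a _; exact: uval_continuous.
Qed.

Lemma orbit_is_chart g : is_chart (orbit_chart g).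
Proof.
split.
- exact: orbit_chart_dom_open.
- rewrite orbit_chart_img.
  apply: (@open_comp _ _ (slice_inv g) (@invertible _ A)).
    by move=> y _; exact: slice_inv_continuous.
  exact: open_invertible.
- by move=> p gp /=; rewrite orbit_chartK// orbit_reprK.
- apply: (orbit_continuous_on (orbit_chart_dom_open g)) => a /orbit_chart_domE ga.
  (* Read through [orbit_pi], the chart agrees with [slice_map g] on [slice_dom g], a neighbourhood
     of a on which continuity is transferred. *)
  have nga : \forall b \near a, slice_dom g (uval b).
    apply: (@uval_continuous R A a); apply: open_nbhs_nbhs; split=> //.
    exact: slice_dom_open.
  have c : {for a, continuous (fun b : units A => slice_map g (uval b))}.
    apply: (@continuous_comp _ _ _ (@uval _ A : units A -> X)).
      exact: uval_continuous.
    apply: (class_C_cont (class_C_slice_map 0 (@slice_dom_open g) _)) => //.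
  move=> W nW; rewrite (_ : (_ \o pi) a = slice_map g (uval a)) in nW; last first.
    exact: orbit_chartE.
  have nW' : nbhs a (fun b : units A => W (slice_map g (uval b))) by exact: (c _ nW).
  apply: (filterS _ (filterI nga nW')) => b [gb Wb].
  by rewrite -(orbit_chartE gb) in Wb.
- rewrite orbit_chart_img => y iy.
  have cu : {for y, continuous (@to_unit R A \o slice_inv g)}.
    apply: (@continuous_comp N X (units A) (slice_inv g) (@to_unit R A)).
      exact: slice_inv_continuous.
    exact: to_unit_continuous.
  exact: (@continuous_comp N (units A) (orbit rho) _ pi y cu (@orbit_pi_continuous R A G rho _)).
Qed.

(** A change of coordinates lifts a class to the slice at g and reads its coordinate for h, so it is
    [slice_map h \o slice_inv g] on an open set. *)
Lemma orbit_smooth_transition g h :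
  smooth_transition (orbit_chart g) (orbit_chart h).
Proof.
move=> k; set U := (X in class_C _ X _).
have oU : open U.
  apply: chart_image_open; first exact: orbit_is_chart.
  exact: orbit_chart_dom_open.
have Uh y : U y -> invertible (slice_inv g y : A) /\ slice_dom h (slice_inv g y).
  move=> [p [gp hp] <-].
  have iy : invertible (slice_inv g (orbit_chart g p) : A).
    exact: slice_map_invertible.
  split=> //; rewrite -(to_unitK iy); apply/orbit_chart_domE.
  by rewrite /= orbit_chartK// orbit_reprK.
apply: (@class_C_eq _ _ _ _ _ (slice_map h \o slice_inv g)) => //.
  move=> y /Uh[iy hy]; rewrite -[RHS]/(orbit_chart h (pi (to_unit (slice_inv g y)))).
  by rewrite orbit_chartE to_unitK.
apply: (@class_C_comp _ _ _ _ _ _ (slice_dom h)) => //.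
- by move=> y /Uh[].
- exact: class_C_slice_inv.
- by apply: class_C_slice_map => //; exact: slice_dom_open.
Qed.

Definition orbit_atlas : atlas R (orbit rho) :=
  atlas_of (fun c => exists g, c = orbit_chart g).

Let Bchart c : (exists g, c = orbit_chart g) -> is_chart c.
Proof. by move=> [g ->]; exact: orbit_is_chart. Qed.
Let Bcover (x : orbit rho) :
  exists2 c, (exists g, c = orbit_chart g) & chart_dom c x.
Proof.
exists (orbit_chart (orbit_repr x)); first by exists (orbit_repr x).
exact: slice_dom_self.
Qed.
Let Bcompat c d : (exists g, c = orbit_chart g) ->
  (exists g, d = orbit_chart g) -> compatible c d.
Proof. by move=> [g ->] [h ->]; split; exact: orbit_smooth_transition. Qed.

Lemma orbit_atlas_maximal : maximal_smooth_atlas orbit_atlas.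
Proof. exact: atlas_of_maximal. Qed.

Lemma orbit_atlas_chart g : orbit_atlas (orbit_chart g).
Proof. by apply: sub_atlas_of => //; exists g. Qed.

Lemma orbit_banach_manifold : banach_manifold orbit_atlas.
Proof. by split; [exact: orbit_hausdorff|exact: orbit_atlas_maximal]. Qed.

Lemma orbit_chart_lift g p : chart_dom (orbit_chart g) p ->
  exists t : units A, uval t = slice_inv g (orbit_chart g p) /\ pi t = p.
Proof.
move=> gp; exists (to_unit (slice_inv g (orbit_chart g p))).
rewrite to_unitK; last exact: slice_map_invertible.
by split=> //=; rewrite orbit_chartK// orbit_reprK.
Qed.

Lemma smooth_orbit_act :
  smooth_map (prod_atlas (units_atlas A) orbit_atlas) orbit_atlas
    (@orbit_act R A G rho).
Proof.
apply: smooth_map_atlas_of => -[a0 p0].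
(* [g] represents the image of (a0, p0), so the target chart is centred there. In coordinates the
   action lifts to [m], that is (a, y) |-> a b0(1 + y), and the source is shrunk to where [m] has
   values in [slice_dom g]. *)
pose b0 := orbit_repr p0; pose g := (a0 * b0)%g.
pose c := prod_chart (units_chart A) (orbit_chart b0).
pose m (w : (X * N)%type) : X := amul A w.1 (slice_inv b0 w.2).
have cc : is_chart c.
  by apply: prod_is_chart; [exact: units_is_chart|exact: orbit_is_chart].
have cm k U : open U -> class_C k U m.
  move=> oU; apply: (class_C_bilin (amul A) oU); first exact: class_C_fst.
  apply: (@class_C_comp _ _ _ _ k U setT snd (slice_inv b0)) => //.
    exact: class_C_snd.
  by apply: class_C_slice_inv; exact: openT.
have oV : open (m @^-1` slice_dom g).
  apply: open_comp; last exact: slice_dom_open.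
  by move=> w _; apply: (class_C_cont (cm 0 setT openT)).
have lift z : chart_dom c z -> exists t : units A,
    [/\ orbit_act z = pi t & uval t = m (c z)].
  case: z => u p [_ /= b0p]; have [t [tE tp]] := orbit_chart_lift b0p.
  exists (u * t)%g; split; first by rewrite -tp orbit_act_pi.
  by rewrite uvalM tE.
exists c, (orbit_chart g); split.
- apply: units_prod_chart; first exact: orbit_atlas_maximal.
  exact: orbit_atlas_chart.
- exact: orbit_atlas_chart.
- by split=> //; exact: slice_dom_self.
exists (chart_dom c `&` c @^-1` (m @^-1` slice_dom g)); split.
- exact: chart_preimage_open.
- have cz : chart_dom c (a0, p0) by split=> //; exact: slice_dom_self.
  split=> //; have [t [tE tm]] := lift _ cz.
  rewrite /= -[slice_dom _ _]/(slice_dom g (m (c (a0, p0)))) -tm.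
  apply/orbit_chart_domE; rewrite -tE -[p0]orbit_reprK orbit_act_pi.
  exact/orbit_chart_domE/slice_dom_self.
- move=> z cz [_ Vz]; have [t [-> tm]] := lift _ cz.
  by apply/orbit_chart_domE; rewrite tm.
move=> k; set U := (X in class_C _ X _).
have oU : open U by apply: chart_image_open => //; exact: chart_preimage_open.
have UV w : U w -> slice_dom g (m w) by move=> [z [_ [_ Vz]] <-].
apply: (@class_C_eq _ _ _ _ _ (slice_map g \o m)) => //.
  move=> _ [z [cz [_ Vz]] <-]; have [_ _ cK _ _] := cc.
  rewrite /comp cK//; have [t [-> tm]] := lift _ cz.
  by rewrite -tm -orbit_chartE// tm.
apply: (@class_C_comp _ _ _ _ k U (slice_dom g)) => //; first exact: cm.
by apply: class_C_slice_map => //; exact: slice_dom_open.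
Qed.

(** At x, s(x) = g^-1 xb and E(s(x)) both equal 1, where inversion has derivative -v. The product
    rule leaves s(w) - E(s(w)), and the projection onto the kernel of E kills the second term. *)
Lemma slice_map_diff (g b : units A) (x : X) :
  (slice_translate g x : A) * uval b = 1 ->
  is_diff x (fun v : X => slice_map g (amul A v (uval b)))
    (fun w => to_kernelL expectationK (slice_translate g (amul A w (uval b)))).
Proof.
move=> x1; pose s : blin X X := bcomp (slice_translate g) (bflip (amul A) (uval b)).
have sx : s x = (1 : A) by rewrite -x1 /s /slice_translate /= mulrA.
have i1 : invertible (1 : A) by exists 1; rewrite mulr1.
have v1 : ainv (1 : A) = (1 : A) by apply: mulrI_inv; rewrite mulr1.
have dinv : is_diff (E (s x)) (@ainv R A) (fun v => - v).
  rewrite sx E1; have [d1 d2] := ainv_diff i1.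
  apply: DiffDef => //; apply/funext => v; rewrite -fderivE// d2 v1.
  rewrite -[LHS]/(- ((1 : A) * ((v : A) * (1 : A)))).
  by rewrite mulr1 mul1r.
have dp : is_diff x (fun v => (s v, ainv (E (s v)))) (fun w => (s w, - E (s w))).
  apply: is_diff_pair; first exact: is_diff_blin.
  apply: (@is_diff_comp _ _ _ _ (E \o s) (E \o s) (@ainv R A) (fun v => - v)) => //.
  exact: (is_diff_blin (bcomp E s)).
have dq := @is_diff_comp _ _ _ _ _ _ _ _ _ dp (bilinear_diff (amul A) _).
have [dd de] := @is_diff_comp _ _ _ _ _ _ _ _ _ dq
  (is_diff_blin (to_kernelL expectationK) _).
apply: DiffDef; first exact: dd.
apply: (etrans de); apply/funext => w.
have K0 y : to_kernelL expectationK (E y) = 0.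
  by apply: kval_inj; rewrite -[LHS]/(E y - E (E y)) expectationK subrr.
have -> : to_kernelL expectationK (slice_translate g (amul A w (uval b))) =
    to_kernelL expectationK (s w - E (s w)).
  by rewrite linearB /= [X in _ - X]K0 subr0.
rewrite /comp /=; congr (to_kernelL expectationK _).
rewrite -[LHS]/((s x : A) * - (E (s w) : A) + (s w : A) * ainv (E (s x))).
by rewrite sx E1 v1 mul1r mulr1 addrC.
Qed.

Lemma mulr_cancel2 (u u' v v' y : A) : u' * u = 1 -> v' * v = 1 ->
  u' * (u * (y * v') * v) = y.
Proof. by move=> uu vv; rewrite -!mulrA vv mulr1 mulrA uu mul1r. Qed.

(** At a0, with g = a0 b, the tangent map is w |-> (1 - E)(g^-1 wb). As w |-> g^-1 wb is an
    isomorphism with inverse [n], the tangent map is onto, and its kernel is the image under [n] of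
    the range of E, onto which the conjugate of E by [n] projects. *)
Lemma submersion_orbit_act (p : orbit rho) :
  submersion (units_atlas A) orbit_atlas (fun a => orbit_act (a, p)).
Proof.
move=> a0; have [b <-] := orbit_pi_surj p.
pose g := (a0 * b)%g; pose m : blin X X := bflip (amul A) (uval b).
have oV : open (m @^-1` slice_dom g).
  apply: open_comp; last exact: slice_dom_open.
  by move=> w _; exact: blin_continuous.
have mE a : uval (a * b)%g = m (uval a) by [].
pose c := restrict_chart (units_chart A) (@uval _ A @^-1` (m @^-1` slice_dom g)).
have cc : units_atlas A c.
  apply: restrict_atlas_of; first exact: units_atlas_chart.
  apply: open_comp => // u _; exact: uval_continuous.
have ca0 : chart_dom c a0.
  split=> //; rewrite /preimage /= -[slice_dom _ _]/(slice_dom g (uval g)).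
  exact: slice_dom_self.
have [icc _] := cc; have [_ oc cK _ _] := icc.
have fE y : chart_img c y -> slice_map g (m y) =
    @local_rep R (units A) (orbit rho) c (orbit_chart g) (fun a => orbit_act (a, pi b)) y.
  move=> [a ca <-]; rewrite /local_rep /comp cK// orbit_act_pi.
  by rewrite orbit_chartE//; case: ca.
have ica : chart_img c (uval a0) by exists a0.
have gab : (slice_translate g (uval a0) : A) * uval b = 1.
  by rewrite -[LHS]/(uval (g^-1 * a0 * b)%g) -mulgA mulVg.
have df := @slice_map_diff g b (uval a0) gab.
have nf : \forall y \near (uval a0 : X), slice_map g (m y) =
    @local_rep R (units A) (orbit rho) c (orbit_chart g) (fun a => orbit_act (a, pi b)) y.
  apply: (@filterS _ (nbhs (uval a0 : X)) _ (chart_img c)) => //.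
  exact: open_nbhs_nbhs.
exists c, (orbit_chart g); split=> //; first exact: orbit_atlas_chart.
  split=> [a [_ ga]|k]; first by rewrite orbit_act_pi; apply/orbit_chart_domE.
  apply: (class_C_eq oc fE).
  apply: (@class_C_comp _ _ _ _ k (chart_img c) (slice_dom g) m (slice_map g)) => //.
  - by move=> _ [a [_ ga] <-].
  - exact: (class_C_blin m oc (class_C_id k _)).
  - by apply: class_C_slice_map => //; exact: slice_dom_open.
have DE w : 'd (@local_rep R (units A) (orbit rho) c (orbit_chart g) (fun a => orbit_act (a, pi b))) (c a0) w
    = to_kernelL expectationK (slice_translate g (m w)).
  exact: near_is_diff nf df w.
set D := 'd _ _ in DE *.
pose n (y : X) : X := (uval g * (y * uval b^-1%g : A)).
have nE y : slice_translate g (m (n y)) = y.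
  rewrite -[LHS]/(uval g^-1%g * (uval g * (y * uval b^-1%g) * uval b)).
  by apply: mulr_cancel2; rewrite -uvalM mulVg.
have nK w : n (slice_translate g (m w)) = w.
  rewrite -[LHS]/(uval g * (uval g^-1%g * (w * uval b) * uval b^-1%g)).
  by apply: mulr_cancel2; rewrite -uvalM mulgV.
split=> [w|].
  exists (n (kval w)); apply: kval_inj; rewrite DE nE.
  by rewrite -[LHS]/(kval w - E (kval w)) kval0 subr0.
pose P : blin X X := bcomp (amul A (uval g)) (bcomp (bflip (amul A) (uval b^-1%g))
  (bcomp E (bcomp (slice_translate g) m))).
have PE v : P v = n (E (slice_translate g (m v))) by [].
exists P; split=> v; first by rewrite !PE nE expectationK.
rewrite DE PE; split=> [vE|/(congr1 (@kval _ _ _))].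
  apply: kval_inj; rewrite -[LHS]/(slice_translate g (m v) - E (slice_translate g (m v))).
  by rewrite -[X in slice_translate g (m X) - _]vE nE subrr.
rewrite -[LHS]/(slice_translate g (m v) - E (slice_translate g (m v))) => /subr0_eq <-.
exact: nK.
Qed.
End orbit_manifold.

(** * Elementary geometry of Hilbert spaces *)

Section hilbert.
Context (R : realType) (H : hilbertSpace R).
Local Notation C := R[i].
Implicit Types (x y z : H) (a : C).

Lemma rnorm_scalar (a : C^o) : rnorm a ^+ 2 = complex.Re a ^+ 2 + complex.Im a ^+ 2.
Proof.
by case: a => u v; rewrite /rnorm normc_def /= sqr_sqrtr// addr_ge0 ?sqr_ge0.
Qed.

Lemma Re_le_rnorm (a : C^o) : `|complex.Re a| <= rnorm a.
Proof.
rewrite -(@ler_pXn2r _ 2) ?nnegrE ?rnorm_ge0// rnorm_scalar.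
by rewrite real_normK ?num_real// lerDl sqr_ge0.
Qed.

Lemma innerDl x y z : inner (x + y) z = inner x z + inner y z.
Proof. by rewrite -[x]scale1r inner_linear mul1r scale1r. Qed.

Lemma inner0l z : inner 0 z = 0.
Proof. by apply: (addrI (inner 0 z)); rewrite -innerDl !addr0. Qed.

Lemma innerZl a x z : inner (a *: x) z = a * inner x z.
Proof. by rewrite -[a *: x]addr0 inner_linear inner0l addr0. Qed.

Lemma innerDr x y z : inner z (x + y) = inner z x + inner z y.
Proof. by rewrite inner_conj innerDl rmorphD/= -!inner_conj. Qed.

Lemma innerZr a x z : inner z (a *: x) = conjc a * inner z x.
Proof. by rewrite inner_conj innerZl rmorphM/= -inner_conj. Qed.

Lemma innerNl x z : inner (- x) z = - inner x z.
Proof. by rewrite -scaleN1r innerZl mulN1r. Qed.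

Lemma innerNr x z : inner z (- x) = - inner z x.
Proof. by rewrite inner_conj innerNl rmorphN/= -inner_conj. Qed.

Lemma inner_self x : inner x x = (rnorm x ^+ 2)%:C%C.
Proof. by rewrite inner_norm -rnormE rmorphXn. Qed.

Lemma rnorm_sqrD x y :
  rnorm (x + y) ^+ 2 = rnorm x ^+ 2 + 2 * complex.Re (inner x y) + rnorm y ^+ 2.
Proof.
apply: (@complexI R); rewrite -inner_self innerDl !innerDr !inner_self.
rewrite (inner_conj x y); case: (inner x y) => u v /=; apply/eqP.
by rewrite eq_complex /=; apply/andP; split; apply/eqP; ring.
Qed.

Lemma rnorm_sqrZ a x : rnorm (a *: x) ^+ 2 = rnorm (a : C^o) ^+ 2 * rnorm x ^+ 2.
Proof. by rewrite rnormZ exprMn. Qed.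

Lemma cauchy_schwarz x y : rnorm (inner x y : C^o) <= rnorm x * rnorm y.
Proof.
have [->|y0] := eqVneq y 0.
  by rewrite inner_conj inner0l rmorph0 !rnorm0 mulr0.
have ny : 0 < rnorm y by rewrite lt_neqAle rnorm_ge0 eq_sym rnorm_eq0 y0.
have ny2 : 0 < rnorm y ^+ 2 by rewrite exprn_gt0.
rewrite -(@ler_pXn2r _ 2) ?nnegrE ?mulr_ge0 ?rnorm_ge0// exprMn.
(* This t minimizes |x + ty|; multiplied by |y|^2, the nonnegativity of the minimum is the
   inequality. *)
pose t : C := - (inner x y / (rnorm y ^+ 2)%:C%C).
have tE : rnorm (t : C^o) = rnorm (inner x y : C^o) / rnorm y ^+ 2.
  rewrite /t rnormN -fmorphV rnorm_scalarM rnorm_normc ger0_norm//.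
  by rewrite invr_ge0 ltW.
have : 0 <= rnorm (x + t *: y) ^+ 2 by rewrite sqr_ge0.
rewrite rnorm_sqrD rnorm_sqrZ tE innerZr.
have -> : complex.Re (conjc t * inner x y) = - (rnorm (inner x y : C^o) ^+ 2 / rnorm y ^+ 2).
  rewrite rnorm_scalar /t -fmorphV; case: (inner x y) => u v /=.
  by ring.
move=> H0; rewrite -subr_ge0; move: (mulr_ge0 H0 (ltW ny2)); congr (0 <= _).
by rewrite expr_div_n; field; rewrite rnorm_eq0.
Qed.

Lemma parallelogram x y :
  rnorm (x + y) ^+ 2 + rnorm (x - y) ^+ 2 = 2 * (rnorm x ^+ 2 + rnorm y ^+ 2).
Proof.
by rewrite !rnorm_sqrD rnormN innerNr raddfN/=; ring.
Qed.
End hilbert.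

(** * Limits of approximations, the Riesz representation and adjoints *)

Section shrinking_limit.
Context (R : realType) (X : completeNormedModType R[i]).

(** P e is to be read as a set of approximations within e of an unknown point. One choice for each e
    = 1/(n+1) gives a Cauchy sequence converging to that point. Used for near-minimizers and for
    averages over a compact group. *)
Lemma shrinking_limit (P : R -> set X) :
  (forall e, 0 < e -> P e !=set0) ->
  (forall e d x y, P e x -> P d y -> rnorm (x - y) <= e + d) ->
  exists z, forall e x, P e x -> rnorm (x - z) <= e.
Proof.
move=> P0 PP.
have Pn n : exists x, P n.+1%:R^-1 x by apply: P0; rewrite invr_gt0 ltr0n.
pose u n : realify X := projT1 (cid (Pn n)).
have uP n : P n.+1%:R^-1 (u n) by rewrite /u; case: cid.
have inv_small (e : R) : 0 < e -> \forall n \near \oo, n.+1%:R^-1 < e.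
  by move=> e0; exact: near_infty_natSinv_lt (PosNum e0).
have cu : cvg (u @ \oo).
  apply: cauchy_cvg; apply: cauchy_exP => e e0.
  have e2 : 0 < e / 2 by rewrite divr_gt0.
  have [N _ HN] := inv_small _ e2.
  exists (u N); exists N => // n Nn /=.
  rewrite -ball_normE /= realify_normE (le_lt_trans (PP _ _ _ _ (uP N) (uP n)))//.
  by rewrite (splitr e) ltrD//; apply: HN => /=.
exists (lim (u @ \oo)) => e x Px; apply/ler_addgt0Pr => d d0.
have d2 : 0 < d / 2 by rewrite divr_gt0.
have /cvgrPdist_lt/(_ _ d2) H2 := cu.
near \oo => n.
have -> : x - lim (u @ \oo) = (x - u n) + ((u n : X) - lim (u @ \oo)).
  by rewrite addrA subrK.
rewrite (le_trans (rnormD _ _))//.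
rewrite (splitr d) addrA lerD//.
  by rewrite (le_trans (PP _ _ _ _ Px (uP n)))// lerD2l ltW//; near: n; exact: inv_small.
by rewrite rnormB ltW//; near: n; exact: H2.
Unshelve. all: by end_near. Qed.
End shrinking_limit.

Section riesz.
Context (R : realType) (H : hilbertSpace R).
Local Notation C := R[i].

Lemma small_le0 (c k : R) : (forall e, 0 < e -> c <= e * k) -> c <= 0.
Proof.
move=> ck; apply/ler_addgt0Pr => e e0; rewrite add0r.
rewrite (le_trans (ck (e / (`|k| + 1)) _))//.
  by rewrite divr_gt0// ltr_wpDl.
rewrite -mulrA ler_piMr ?(ltW e0)// mulrC ler_pdivrMr ?ltr_wpDl// mul1r.
by rewrite (le_trans (ler_norm k))// lerDl.
Qed.

(* The representing vector minimizes |x|^2 - 2 Re f x. *)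
Lemma riesz_representation (f : H -> C^o) (K : R) :
  (forall a x y, f (a *: x + y) = a * f x + f y) ->
  (forall x, rnorm (f x) <= K * rnorm x) ->
  exists z, forall x, f x = inner x z.
Proof.
move=> fl fK.
have fD x y : f (x + y) = f x + f y by rewrite -[x]scale1r fl mul1r scale1r.
have f0 : f 0 = 0 by apply: (addrI (f 0)); rewrite -fD !addr0.
have fZ a x : f (a *: x) = a * f x by rewrite -[a *: x]addr0 fl f0 addr0.
pose q x := rnorm x ^+ 2 - 2 * complex.Re (f x).
have qD x h : q (x + h) = q x + 2 * complex.Re (inner h x - f h) + rnorm h ^+ 2.
  by rewrite /q [x + h]addrC rnorm_sqrD fD !raddfD/= raddfN/=; ring.
have qmid x y : rnorm (x - y) ^+ 2 = 2 * (q x + q y - 2 * q (2^-1 *: (x + y))).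
  have -> : q (2^-1 *: (x + y)) = rnorm (x + y) ^+ 2 / 4 - complex.Re (f x + f y).
    rewrite /q rnorm_sqrZ fZ fD.
    have -> : (2^-1 : C) = (2^-1)%:C%C by rewrite fmorphV rmorph_nat.
    rewrite rnorm_normc ger0_norm//.
    by case: (f x) (f y) => u v [u' v'] /=; field.
  rewrite /q raddfD/=; have := parallelogram x y; lra.
have qlb x : - K ^+ 2 <= q x.
  have h1 : complex.Re (f x) <= K * rnorm x.
    by rewrite (le_trans (ler_norm _))// (le_trans (Re_le_rnorm _)).
  have : 0 <= (rnorm x - K) ^+ 2 by rewrite sqr_ge0.
  by rewrite /q; nra.
have hq : has_inf (range q).
  by split; [exists (q 0), 0|exists (- K ^+ 2) => _ [x _ <-]].
pose m := inf (range q).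
have mq x : m <= q x by apply: ge_inf; [exact: hq.2|exists x].
(* With tolerance e^2/2 the parallelogram identity gives |x - y|^2 <= 2(q(x) + q(y) - 2m) <= e^2 +
   d^2 <= (e + d)^2. *)
pose P (e : R) : set H := [set x | 0 < e /\ q x <= m + e ^+ 2 / 2].
have [||z zP] := @shrinking_limit _ _ P.
- move=> e e0; have e2 : 0 < e ^+ 2 / 2 by rewrite divr_gt0// exprn_gt0.
  have [_ [x _ <-] xm] := @inf_adherent _ _ _ e2 hq.
  by exists x; split=> //; exact: ltW.
- move=> e d x y [e0 xe] [d0 yd].
  rewrite -(@ler_pXn2r _ 2) ?nnegrE ?rnorm_ge0 ?addr_ge0 ?ltW// qmid.
  have := mq (2^-1 *: (x + y)); nra.
exists z.
(* First variation at a near-minimizer x in the direction eh: m <= q(x + eh) and q(x) <= m + e^2/2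
   bound Re(f(h) - <h, x>) by a multiple of e. Below, -h gives the opposite inequality and ih the
   imaginary part. *)
have key h : complex.Re (f h - inner h z) <= 0.
  apply: (@small_le0 _ ((rnorm h ^+ 2 + 1) / 2 + rnorm h)) => e e0.
  have e2 : 0 < e ^+ 2 / 2 by rewrite divr_gt0// exprn_gt0.
  have [_ [x _ <-] xm] := @inf_adherent _ _ _ e2 hq.
  have xz : rnorm (x - z) <= e by apply: zP; split=> //; exact: ltW.
  have := qD x (e%:C%C *: h); rewrite rnorm_sqrZ rnorm_normc (ger0_norm (ltW e0)).
  rewrite innerZl fZ -mulrBr.
  have -> : complex.Re (e%:C%C * (inner h x - f h)) = e * complex.Re (inner h x - f h).
    by case: (_ - _) => u v /=; ring.
  move=> qxe; have := mq (x + e%:C%C *: h); rewrite qxe => mle.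
  have c1 : complex.Re (f h - inner h x) <= e * ((rnorm h ^+ 2 + 1) / 2).
    rewrite -(ler_pM2l e0) -[f h - _]opprB raddfN/=.
    move: xm mle; rewrite -/m; set r := complex.Re _; nra.
  have c2 : complex.Re (inner h (x - z)) <= e * rnorm h.
    rewrite (le_trans (ler_norm _))// (le_trans (Re_le_rnorm _))//.
    by rewrite (le_trans (cauchy_schwarz _ _))// mulrC ler_wpM2r// rnorm_ge0.
  have -> : f h - inner h z = (f h - inner h x) + inner h (x - z).
    by rewrite innerDr innerNr addrA subrK.
  by rewrite raddfD/= mulrDr lerD.
have fN h : f (- h) = - f h by rewrite -scaleN1r fZ mulN1r.
have Re0 h : complex.Re (f h - inner h z) = 0.
  apply/eqP; rewrite eq_le key/= -oppr_le0 -raddfN/=.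
  by have := key (- h); rewrite fN innerNl -opprD.
move=> h; apply/eqP; rewrite -subr_eq0 eq_complex Re0 eqxx/=.
have := Re0 ('i%C *: h); rewrite fZ innerZl -mulrBr.
by case: (_ - _) => u v /=; rewrite mul0r mul1r sub0r => /eqP; rewrite oppr_eq0.
Qed.

Lemma blin_bounded (X Y : normedModType C) (T : blin X Y) :
  exists2 K : R, 0 <= K & forall x, rnorm (T x) <= K * rnorm x.
Proof.
have [+ _] := linear_boundedP T.
have [_ /(_ (@blin_continuous _ _ _ T)) bT] := linear_bounded_continuous T.
move=> /(_ bT) [M [Mr HM]].
have M1 : M <= (rnorm (M : C^o))%:C%C by rewrite (rnormE (M : C^o)) real_ler_norm.
exists (rnorm (M : C^o) + 1) => [|x]; first by rewrite addr_ge0 ?rnorm_ge0.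
rewrite -lecR rmorphM/= !rnormE; apply: HM.
by rewrite (le_lt_trans M1)// ltcR ltrDl.
Qed.

Lemma adjoint_exists (T : blin H H) (y : H) :
  exists z, forall x, inner (T x) y = inner x z.
Proof.
have [K K0 TK] := blin_bounded T.
apply: (@riesz_representation (fun x => inner (T x) y) (K * rnorm y)).
  by move=> a u v; rewrite linearP inner_linear.
move=> x; rewrite (le_trans (cauchy_schwarz _ _))// mulrAC.
by rewrite ler_wpM2r ?rnorm_ge0.
Qed.
End riesz.

(** * Operator matrices over a one-element index set *)

Section singleton_matrix.
Context (R : realType) (H : normedModType R[i]) (I : finType) (i0 : I).
Hypothesis Ii0 : forall i : I, i = i0.

Lemma sum_singleton (V : nmodType) (F : I -> V) : \sum_i F i = F i0.
Proof. by rewrite (big_pred1 i0)// => i /=; rewrite (Ii0 i) eqxx. Qed.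

Lemma l2norm_singleton (x : I -> H) : l2norm x = rnorm (x i0).
Proof. by rewrite /l2norm sum_singleton sqrtr_sqr ger0_norm// rnorm_ge0. Qed.

Let imageE (T : I -> I -> H -> H) :
  [set l2norm (fun i => \sum_j T i j (x j)) | x in [set x : I -> H | l2norm x <= 1]] =
  [set rnorm (T i0 i0 x) | x in [set x | rnorm x <= 1]].
Proof.
apply/seteqP; split=> [_ [x /= x1 <-]|_ [x /= x1 <-]].
  by exists (x i0); rewrite /= ?l2norm_singleton ?sum_singleton// -l2norm_singleton.
by exists (fun=> x); rewrite /= ?l2norm_singleton ?sum_singleton.
Qed.

(** Some bound K is assumed because the supremum of an unbounded set is 0. *)
Lemma mxopnorm_ge (T : I -> I -> H -> H) (K : R) (x : H) :
  (forall a y, T i0 i0 (a *: y) = a *: T i0 i0 y) ->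
  (forall y, rnorm (T i0 i0 y) <= K * rnorm y) ->
  rnorm (T i0 i0 x) <= mxopnorm T * rnorm x.
Proof.
move=> TZ TK; have [->|x0] := eqVneq x 0.
  by rewrite -[X in T _ _ X](scale0r 0) TZ scale0r !rnorm0 mulr0.
have nx : 0 < rnorm x by rewrite lt_neqAle rnorm_ge0 eq_sym rnorm_eq0 x0.
have c0 : 0 <= (rnorm x)^-1 by rewrite invr_ge0 ltW.
rewrite -ler_pdivrMr// /mxopnorm imageE; apply: ub_le_sup.
  exists `|K| => _ [y /= y1 <-]; rewrite (le_trans (TK y))//.
  rewrite (le_trans (ler_norm _))// normrM [`|rnorm y|]ger0_norm ?rnorm_ge0//.
  by rewrite ler_piMr.
exists ((rnorm x)^-1%:C%C *: x) => /=.
  by rewrite rnormZ rnorm_normc ger0_norm// mulVf// gt_eqF.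
by rewrite TZ rnormZ rnorm_normc ger0_norm// mulrC.
Qed.

Lemma mxopnorm_le (T : I -> I -> H -> H) (K : R) : 0 <= K ->
  (forall y, rnorm (T i0 i0 y) <= K * rnorm y) -> mxopnorm T <= K.
Proof.
move=> K0 TK; rewrite /mxopnorm imageE; apply: ge_sup.
  by exists (rnorm (T i0 i0 0)), 0; rewrite //= rnorm0.
by move=> _ [y /= y1 <-]; rewrite (le_trans (TK y))// ler_piMr.
Qed.
End singleton_matrix.

(** * Means on bounded uniformly continuous functions *)

Section means.
Context (R : realType) (G : topologicalGroupType).
Local Notation C := (R[i]^o).
Implicit Types f h : G -> C.

(** The uniformity condition of [RUCb], for vector-valued functions too: bounded functionals of g
    |-> rho(g) a rho(g)^-1 inherit it from that function. *)
Definition left_uniform (V : normedModType R[i]) (F : G -> V) : Prop :=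
  forall (s0 : G) (e : R), 0 < e ->
    \forall s \near s0, forall g, rnorm (F (s * g)%g - F (s0 * g)%g) <= e.

Lemma supnorm_le f (M : R) : (forall g, rnorm (f g) <= M) -> supnorm f <= M.
Proof.
by move=> fM; apply: ge_sup; [exists (rnorm (f 1%g)), 1%g|move=> _ [g _ <-]].
Qed.

Lemma supnorm_ge f g : has_ubound (range (fun s => rnorm (f s))) ->
  rnorm (f g) <= supnorm f.
Proof. by move=> fb; apply: ub_le_sup => //; exists g. Qed.

(** The uniform condition at g = 1 already gives continuity; passing from weak to strict inequality
    costs the factor 1/2. *)
Lemma RUCbP f : RUCb f <->
  (exists M, forall g, rnorm (f g) <= M) /\ left_uniform f.
Proof.
split=> [[[M fM] cf uf]|[[M fM] uf]].
  have fM' g : rnorm (f g) <= M by apply: fM; exists g.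
  split; first by exists M.
  move=> s0 e e0; apply: filterS (uf s0 e e0) => s /= /ltW fe g.
  apply: le_trans fe; rewrite -[X in rnorm X]/((ltrans s f \- ltrans s0 f) g).
  apply: supnorm_ge; exists (M + M) => _ [t _ <-] /=.
  by rewrite (le_trans (rnormD _ _))// rnormN lerD// /ltrans.
split; first by exists M => _ [g _ <-].
- move=> s0; apply/cvgrPdist_le => e e0.
  have eE : e = (complex.Re e)%:C%C.
    by move: e0; case: e => u v; rewrite ltcE/= => /andP[/eqP -> _].
  rewrite eE; rewrite eE ltcR in e0; apply: filterS (uf s0 _ e0) => s /(_ 1%g).
  by rewrite !mulg1 -rnormE lecR rnormB.
- move=> s0 e e0; have e2 : 0 < e / 2 by rewrite divr_gt0.
  apply: filterS (uf s0 _ e2) => s fs.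
  rewrite (@le_lt_trans _ _ (e / 2))//; last by rewrite ltr_pdivrMr// ltr_pMr// ltr1n.
  exact: supnorm_le.
Qed.

Lemma RUCb_linear (a : R[i]) f h : RUCb f -> RUCb h -> RUCb (a *: f + h).
Proof.
move=> /RUCbP[[M fM] uf] /RUCbP[[N hN] uh]; apply/RUCbP; split.
  exists (rnorm (a : C) * M + N) => g; rewrite (le_trans (rnormD _ _))// lerD//.
  by rewrite rnormZ ler_wpM2l ?rnorm_ge0.
move=> s0 e e0; pose k := rnorm (a : C) + 1.
have k0 : 0 < k by rewrite ltr_wpDl ?rnorm_ge0.
have e1 : 0 < e / (2 * k) by rewrite divr_gt0// mulr_gt0.
have e2 : 0 < e / 2 by rewrite divr_gt0.
apply: filterS2 (uf s0 _ e1) (uh s0 _ e2) => s fs hs g.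
rewrite -[X in rnorm X]/(a *: f (s * g)%g + h (s * g)%g - (a *: f (s0 * g)%g + h (s0 * g)%g)).
rewrite opprD addrACA -scalerBr (le_trans (rnormD _ _))// (splitr e) lerD// rnormZ.
have -> : e / 2 = k * (e / (2 * k)) by field; rewrite gt_eqF.
by apply: ler_pM; rewrite ?rnorm_ge0// lerDl.
Qed.

Lemma RUCb_cst (c : C) : RUCb (cst c : G -> C).
Proof.
apply/RUCbP; split=> [|s0 e e0]; first by exists (rnorm c).
by apply: filterE => s g; rewrite subrr rnorm0 ltW.
Qed.

Context (mu : (G -> C) -> C).
Hypothesis mu_linear : forall (a : R[i]) f h, RUCb f -> RUCb h ->
  mu (a *: f + h) = a * mu f + mu h.
Hypothesis mu_sup :
  sup [set rnorm (mu f) | f in @RUCb R G `&` [set f | supnorm f <= 1]] = 1.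
Hypothesis mu1 : mu (cst 1) = 1.

Lemma mean0 : mu 0 = 0.
Proof.
have := @mu_linear 1 (cst 0) (cst 0) (RUCb_cst 0) (RUCb_cst 0).
by rewrite scale1r addr0 mul1r => /esym/eqP; rewrite -subr_eq0 addrK => /eqP.
Qed.

Lemma meanZ (a : R[i]) f : RUCb f -> mu (a *: f) = a * mu f.
Proof.
by move=> uf; rewrite -[a *: f]addr0 mu_linear// ?mean0 ?addr0//; exact: (RUCb_cst 0).
Qed.

Lemma mean_cst (c : R[i]) : mu (cst c) = c.
Proof.
have -> : cst c = c *: cst 1 :> (G -> C).
  by apply/funext => g; rewrite -[RHS]/(c * 1) mulr1.
by rewrite meanZ ?mu1 ?mulr1//; exact: RUCb_cst.
Qed.

Lemma mean_le f (M : R) : RUCb f -> (forall g, rnorm (f g) <= M) ->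
  rnorm (mu f) <= M.
Proof.
move=> uf fM; have M0 : 0 <= M := le_trans (rnorm_ge0 (f 1%g)) (fM 1%g).
(* M may be 0, so f is normalized by M + e. *)
apply/ler_addgt0Pr => e e0; have Me : 0 < M + e by rewrite ltr_wpDl.
have c0 : 0 <= (M + e)^-1 by rewrite invr_ge0 ltW.
(* As a set without supremum gets the value 0, the value 1 forces boundedness. *)
have bmu : has_sup [set rnorm (mu f) | f in @RUCb R G `&` [set f | supnorm f <= 1]].
  by apply: contrapT => /sup_out; rewrite mu_sup => /eqP; rewrite oner_eq0.
have uh : RUCb ((M + e)^-1%:C%C *: f).
  by rewrite -[X in RUCb X]addr0; apply: RUCb_linear uf (RUCb_cst 0).
have : rnorm (mu ((M + e)^-1%:C%C *: f)) <= 1.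
  rewrite -mu_sup; apply: ub_le_sup; first exact: bmu.2.
  eexists; last by [].
  split=> //; apply: supnorm_le => g.
  rewrite -[X in rnorm X]/((M + e)^-1%:C%C *: f g) rnormZ rnorm_normc ger0_norm//.
  by rewrite mulrC ler_pdivrMr// mul1r (le_trans (fM g))// lerDl ltW.
rewrite meanZ// rnorm_scalarM rnorm_normc ger0_norm//.
by rewrite mulrC ler_pdivrMr// mul1r.
Qed.

Lemma mean_sum (I : Type) (r : seq I) (a : I -> R[i]) (f : I -> G -> C) :
  (forall i, RUCb (f i)) ->
  RUCb (fun g => \sum_(i <- r) a i * f i g) /\
  mu (fun g => \sum_(i <- r) a i * f i g) = \sum_(i <- r) a i * mu (f i).
Proof.
move=> uf; elim: r => [|i r [uIH IH]].
  rewrite (_ : (fun g => _) = cst 0); last by apply/funext => g; rewrite big_nil.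
  by rewrite big_nil mean_cst; split=> //; exact: RUCb_cst.
rewrite (_ : (fun g => _) = a i *: f i + (fun g => \sum_(i <- r) a i * f i g)).
  by split; [exact: RUCb_linear|rewrite mu_linear// IH big_cons].
by apply/funext => g; rewrite big_cons.
Qed.
End means.

(** * The bounded uniformly continuous function g |-> rho(g) a rho(g)^-1 *)

Section conjugation_average.
Context (R : realType) (G : topologicalGroupType) (A : banachAlgType R[i]).
Context (rho : G -> units A).
Hypothesis hrho : bounded_reps rho.
Local Notation C := (R[i]^o).

Definition rep_conj (a : A) (g : G) : A :=
  uval (rho g) * a * uval (rho g)^-1%g.

Lemma rho1 : rho 1%g = 1%g.
Proof.
have [_ rM _] := hrho; apply: (mulgI (rho 1%g)).
by rewrite -rM !mulg1.
Qed.

Lemma rhoV g : rho g^-1%g = (rho g)^-1%g.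
Proof.
have [_ rM _] := hrho; apply: (mulgI (rho g)).
by rewrite -rM !mulgV rho1.
Qed.

Lemma rho_bounded : exists K : R, forall g,
  rnorm (uval (rho g)) <= K /\ rnorm (uval (rho g)^-1%g) <= K.
Proof.
have [_ _ [K rK]] := hrho; exists K => g.
by rewrite -rhoV; split; apply: rK; eexists.
Qed.

Lemma rep_conj_bounded : exists2 K : R, 0 <= K &
  forall a g, rnorm (rep_conj a g) <= K * rnorm a.
Proof.
have [K rK] := rho_bounded.
have K0 : 0 <= K := le_trans (rnorm_ge0 _) (rK 1%g).1.
exists (K * K) => [|a g]; first exact: mulr_ge0.
rewrite (le_trans (rnormM _ _))// mulrAC.
apply: ler_pM; rewrite ?rnorm_ge0//; last by have [] := rK g.
by rewrite (le_trans (rnormM _ _))// ler_wpM2r ?rnorm_ge0//; have [] := rK g.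
Qed.

Lemma rep_conjM a t g :
  rep_conj a (t * g)%g = uval (rho t) * rep_conj a g * uval (rho t)^-1%g.
Proof.
by have [_ rM _] := hrho; rewrite /rep_conj rM invgM !uvalM !mulrA.
Qed.

Lemma rep_conj_mulr a b g : commutes_with_rep rho b ->
  rep_conj (a * b) g = rep_conj a g * b.
Proof.
move=> cb; rewrite /rep_conj -!mulrA; congr (_ * (_ * _)).
by rewrite -rhoV cb.
Qed.

Lemma rep_conj1 g : rep_conj 1 g = 1.
Proof. by rewrite /rep_conj mulr1 -uvalM mulgV. Qed.

Lemma rep_conj_linear (c : R[i]) a b g :
  rep_conj (c *: a + b) g = c *: rep_conj a g + rep_conj b g.
Proof.
by rewrite /rep_conj mulrDr mulrDl scaler_mulAl scaler_mulAr.
Qed.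

Lemma near_uval (T : topologicalType) (f : T -> units A) (s0 : T) (e : R) :
  continuous f -> 0 < e ->
  \forall s \near s0, rnorm (uval (f s) - uval (f s0)) < e.
Proof.
move=> cf e0; have cu : {for s0, continuous (fun s => uval (f s) : realify A)}.
  by apply: continuous_comp; [exact: cf|exact: uval_continuous].
have /cvgrPdist_lt/(_ e e0) := cu; apply: filterS => s.
by rewrite realify_normE rnormB.
Qed.

(** For F(g) = rho(g) a rho(g)^-1, F(sg) = rho(s) F(g) rho(s)^-1 with F bounded; so norm continuity
    of rho and of its inverse at s0 controls the variation uniformly in g. *)
Lemma rep_conj_left_uniform a : left_uniform (rep_conj a).
Proof.
move=> s0 e e0; have [K rK] := rho_bounded.
have [L L0 cL] := rep_conj_bounded.
have K0 : 0 <= K := le_trans (rnorm_ge0 _) (rK 1%g).1.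
have [rc _ _] := hrho.
(* M bounds the factors ub and bv' of the differences u' - v' and u - v, each smaller than
   e/(2M). *)
pose M := K * (L * rnorm a) + 1.
have KL0 : 0 <= K * (L * rnorm a) by rewrite !mulr_ge0 ?rnorm_ge0.
have M0 : 0 < M by rewrite ltr_wpDl.
have d0 : 0 < e / (2 * M) by rewrite divr_gt0// mulr_gt0.
have rVc : continuous (fun s => (rho s)^-1%g).
  rewrite (_ : (fun _ => _) = rho \o (fun s => s^-1%g)); last by apply/funext => s /=; rewrite rhoV.
  by move=> s; apply: continuous_comp; [exact: invg_continuous|exact: rc].
apply: filterS2 (near_uval s0 rc d0) (near_uval s0 rVc d0) => s r1 r2 g.
rewrite !rep_conjM; set b := rep_conj a g; set u := uval (rho s) in r1 *.
set v := uval (rho s0) in r1 *; set u' := uval _ in r2 *; set v' := uval _ in r2 *.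
have bL : rnorm b <= L * rnorm a by exact: cL.
have uK : rnorm u <= K by have [] := rK s.
have vK : rnorm v' <= K by have [] := rK s0.
have -> : u * b * u' - v * b * v' = u * b * (u' - v') + (u - v) * b * v'.
  by rewrite !(mulrBr, mulrBl) addrA subrK.
rewrite (le_trans (rnormD _ _))// (splitr e) lerD//.
  rewrite (le_trans (rnormM _ _))//.
  have -> : e / 2 = M * (e / (2 * M)) by field; rewrite gt_eqF.
  apply: ler_pM; rewrite ?rnorm_ge0 ?(ltW r2)// (le_trans (rnormM _ _))//.
  by rewrite (@le_trans _ _ (K * (L * rnorm a))) ?ler_pM ?rnorm_ge0// lerDl.
rewrite -mulrA (le_trans (rnormM _ _))//.
have -> : e / 2 = e / (2 * M) * M by field; rewrite gt_eqF.
apply: ler_pM; rewrite ?rnorm_ge0 ?(ltW r1)// (le_trans (rnormM _ _))// mulrC.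
by rewrite (@le_trans _ _ (K * (L * rnorm a))) ?ler_pM ?rnorm_ge0// lerDl.
Qed.

Definition bounded_functional (psi : A -> C) (K : R) : Prop :=
  (forall (c : R[i]) a b, psi (c *: a + b) = c * psi a + psi b) /\
  forall a, rnorm (psi a) <= K * rnorm a.

Lemma bounded_functionalB psi K a b : bounded_functional psi K ->
  psi (a - b) = psi a - psi b.
Proof.
move=> [pl _]; have := pl (-1) b a.
by rewrite scaleN1r mulN1r addrC => ->; rewrite addrC.
Qed.

Lemma RUCb_functional psi K a : bounded_functional psi K ->
  RUCb (psi \o rep_conj a).
Proof.
move=> bp; have [pl pK] := bp; have [L L0 cL] := rep_conj_bounded.
have pK' b : rnorm (psi b) <= (`|K| + 1) * rnorm b.
  rewrite (le_trans (pK b))// ler_wpM2r ?rnorm_ge0//.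
  by rewrite (le_trans (ler_norm K))// lerDl.
have K1 : 0 < `|K| + 1 by rewrite ltr_wpDl.
apply/RUCbP; split.
  exists ((`|K| + 1) * (L * rnorm a)) => g.
  by rewrite (le_trans (pK' _))// ler_wpM2l// ltW.
move=> s0 e e0; have d0 : 0 < e / (`|K| + 1) by rewrite divr_gt0.
apply: filterS (rep_conj_left_uniform a s0 d0) => s H g.
rewrite /= -(bounded_functionalB _ _ bp) (le_trans (pK' _))//.
by rewrite mulrC -ler_pdivlMr.
Qed.
End conjugation_average.

(** * The expectation onto the commutant *)

Section expectation.
Context (R : realType) (G : topologicalGroupType) (A : banachAlgType R[i]).
Context (rho : G -> units A).
Hypothesis hrho : bounded_reps rho.
Local Notation C := (R[i]^o).
Context (mu : (G -> C) -> C).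
Hypothesis mu_linear : forall (a : R[i]) f h, RUCb f -> RUCb h ->
  mu (a *: f + h) = a * mu f + mu h.
Hypothesis mu_sup :
  sup [set rnorm (mu f) | f in @RUCb R G `&` [set f | supnorm f <= 1]] = 1.
Hypothesis mu1 : mu (cst 1) = 1.
Hypothesis mu_inv : forall t f, RUCb f -> mu (ltrans t f) = mu f.
Context (H : hilbertSpace R) (phi : {linear A -> blin H H}).
Hypothesis phiM : homomorphism phi.
Hypothesis phi_le : forall a x, rnorm (phi a x) <= rnorm a * rnorm x.
Hypothesis phi_ge : forall a (K : R), 0 <= K ->
  (forall x, rnorm (phi a x) <= K * rnorm x) -> rnorm a <= K.

Definition coefficient (x y : H) (a : A) : C := inner (phi a x) y.

Lemma coefficient_bounded x y :
  bounded_functional (coefficient x y) (rnorm x * rnorm y).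
Proof.
split=> [c a b|a]; rewrite /coefficient.
  by rewrite linearP -[blin_fun _ x]/(c *: phi a x + phi b x) inner_linear.
rewrite (le_trans (cauchy_schwarz _ _))// mulrAC ler_wpM2r ?rnorm_ge0//.
by rewrite mulrC.
Qed.

(** Take y = phi(a)x and cancel |phi(a)x|. *)
Lemma coefficient_le a (K : R) : 0 <= K ->
  (forall x y, rnorm (coefficient x y a) <= K * (rnorm x * rnorm y)) ->
  rnorm a <= K.
Proof.
move=> K0 aK; apply: phi_ge => // x.
have [->|x0] := eqVneq (phi a x) 0; first by rewrite rnorm0 mulr_ge0 ?rnorm_ge0.
have n0 : 0 < rnorm (phi a x) by rewrite lt_neqAle rnorm_ge0 eq_sym rnorm_eq0 x0.
have := aK x (phi a x); rewrite /coefficient inner_self rnorm_normc.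
by rewrite ger0_norm ?sqr_ge0// expr2 mulrA ler_pM2r.
Qed.

Lemma coefficient_inj a b :
  (forall x y, coefficient x y a = coefficient x y b) -> a = b.
Proof.
move=> ab; apply/eqP; rewrite -subr_eq0 -rnorm_eq0 eq_le rnorm_ge0 andbT.
apply: coefficient_le => // x y.
by rewrite (bounded_functionalB _ _ (coefficient_bounded x y)) ab subrr rnorm0 mul0r.
Qed.

Definition is_weak_average (a b : A) : Prop := forall x y,
  coefficient x y b = mu (coefficient x y \o rep_conj rho a).

Let coefRUC x y a := RUCb_functional hrho a (coefficient_bounded x y).

Lemma weak_average_linear (c : R[i]) a b a' b' :
  is_weak_average a a' -> is_weak_average b b' ->
  is_weak_average (c *: a + b) (c *: a' + b').
Proof.
move=> aa bb x y; have [pl _] := coefficient_bounded x y.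
rewrite pl aa bb -mu_linear; [|exact: coefRUC|exact: coefRUC].
by congr mu; apply/funext => g /=; rewrite rep_conj_linear pl.
Qed.

(** b passes through the conjugations and is absorbed in the vector: <phi(ab)x, y> =
    <phi(a)(phi(b)x), y>. *)
Lemma weak_average_mulr a a' b : commutes_with_rep rho b ->
  is_weak_average a a' -> is_weak_average (a * b) (a' * b).
Proof.
move=> cb aa x y; rewrite /coefficient phiM -/(coefficient _ _ _) aa.
by congr mu; apply/funext => g; rewrite /= /coefficient rep_conj_mulr// phiM.
Qed.

Lemma weak_average1 : is_weak_average 1 1.
Proof.
move=> x y; rewrite [RHS](_ : _ = mu (cst (coefficient x y 1))).
  by rewrite (mean_cst mu_linear mu1).
by congr mu; apply/funext => g; rewrite /= rep_conj1.
Qed.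

(** With F(g) = rho(g) a rho(g)^-1, invariance is applied through F(tg) rho(t) = rho(t) F(g); the
    vector z is the adjoint of phi(rho(t)) at y. *)
Lemma weak_average_comm a a' : is_weak_average a a' ->
  commutes_with_rep rho a'.
Proof.
move=> aa t; apply: coefficient_inj => x y.
have [z zE] := adjoint_exists (phi (uval (rho t))) y.
rewrite /coefficient !phiM zE -[LHS]/(coefficient x z a') -[RHS]/(coefficient _ y a').
rewrite !aa -[RHS](mu_inv t); last exact: coefRUC.
congr mu; apply/funext => g; rewrite /ltrans /= (rep_conjM hrho) /coefficient.
rewrite -zE -!phiM; congr (inner (phi _ x) y).
by rewrite -[RHS]mulrA -uvalM mulVg uval1 mulr1.
Qed.

Lemma weak_average_bounded : exists K : R, forall a a',
  is_weak_average a a' -> rnorm a' <= K * rnorm a.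
Proof.
have [K K0 cK] := rep_conj_bounded hrho; exists K => a a' aa.
apply: coefficient_le => [|x y]; first by rewrite mulr_ge0 ?rnorm_ge0.
rewrite aa; apply: (mean_le mu_linear mu_sup); first exact: coefRUC.
move=> g; have [_ pK] := coefficient_bounded x y.
by rewrite (le_trans (pK _))// mulrC ler_wpM2r ?mulr_ge0 ?rnorm_ge0.
Qed.

Lemma weak_average_uniq a b c : is_weak_average a b -> is_weak_average a c ->
  b = c.
Proof. by move=> ab ac; apply: coefficient_inj => x y; rewrite ab ac. Qed.

(** Averages are unique, so any choice of them is linear and inherits the module property and the
    value at 1. *)
Lemma expectation_exists : (forall a, exists b, is_weak_average a b) ->
  exists E : blin (realify A) (realify A),
    [/\ forall a, commutes_with_rep rho (E a),
        forall a b : A, commutes_with_rep rho b -> E (a * b) = (E a : A) * b &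
        E (1 : A) = (1 : A)].
Proof.
move=> /choice[E0 E0P]; have [K EK] := weak_average_bounded.
have lE : linear (E0 : realify A -> realify A).
  move=> c a b; apply: weak_average_uniq (E0P _) _.
  exact: weak_average_linear.
have bE a : `|(E0 : realify A -> realify A) a| <= K * `|a : realify A|.
  exact: EK.
exists (mkblin lE bE); split.
- by move=> a; exact: weak_average_comm (E0P a).
- move=> a b cb; apply: weak_average_uniq (E0P _) _.
  exact: weak_average_mulr.
- by apply: weak_average_uniq (E0P _) _; exact: weak_average1.
Qed.
End expectation.

(** * Averages over a compact group *)

Section compact_average.
Context (R : realType) (G : topologicalGroupType) (A : banachAlgType R[i]).
Context (rho : G -> units A).
Hypothesis hrho : bounded_reps rho.
Local Notation C := (R[i]^o).
Context (mu : (G -> C) -> C).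
Hypothesis mu_linear : forall (a : R[i]) f h, RUCb f -> RUCb h ->
  mu (a *: f + h) = a * mu f + mu h.
Hypothesis mu_sup :
  sup [set rnorm (mu f) | f in @RUCb R G `&` [set f | supnorm f <= 1]] = 1.
Hypothesis mu1 : mu (cst 1) = 1.
Context (H : hilbertSpace R) (phi : {linear A -> blin H H}).
Hypothesis phi_le : forall a x, rnorm (phi a x) <= rnorm a * rnorm x.
Hypothesis phi_ge : forall a (K : R), 0 <= K ->
  (forall x, rnorm (phi a x) <= K * rnorm x) -> rnorm a <= K.

Hypothesis compactG : compact [set: G].

Lemma max0_lipschitz (x y : R) : `|Num.max 0 x - Num.max 0 y| <= `|x - y|.
Proof.
by rewrite /Num.max; case: ltP => x0; case: ltP => y0; case: (ltP (x - y) 0) => xy;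
  rewrite ?(ltr0_norm xy) ?(ger0_norm xy) ?ler_norml; lra.
Qed.

Variable a : A.
Let F := rep_conj rho a.

Lemma finite_net (e : R) : 0 < e ->
  exists s : seq G, forall g, exists2 i, i \in s & rnorm (F g - F i) < e.
Proof.
(* The filter of properties of all large enough finite lists. Each g has a neighbourhood that is
   covered as soon as the list contains g; compactness makes one list serve all of G. *)
move=> e0; pose eventually_in (S : set (seq G)) : Prop :=
  exists s0 : seq G, forall s : seq G, {subset s0 <= s} -> S s.
have FF : Filter eventually_in.
  split=> [|S T [s sS] [t tT]|S T ST [s sS]].
  - by exists [::].
  - exists (s ++ t) => r str; split; [apply: sS|apply: tT] => i ir;
      by apply: str; rewrite mem_cat ir ?orbT.
  - by exists s => r /sS/ST.
have /compact_near_coveringP/(_ _ eventually_in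
  (fun s g => exists2 i, i \in s & rnorm (F g - F i) < e) FF) := compactG.
case=> [g _|s /(_ s (fun _ => id)) Hs]; last by exists s => g; exact: Hs.
have e2 : 0 < e / 2 by rewrite divr_gt0.
exists ([set h | rnorm (F h - F g) < e], [set s : seq G | g \in s]).
  split; last by exists [:: g] => s; apply; rewrite mem_head.
  apply: filterS (rep_conj_left_uniform hrho a g e2) => h /(_ 1%g).
  by rewrite !mulg1 /= => hg; rewrite (le_lt_trans hg)//; lra.
by move=> [h s] [/= hg gs]; exists g.
Qed.

Section partition_of_unity.
Variables (e : R) (s : seq G).
Hypothesis e0 : 0 < e.
Hypothesis net : forall g, exists2 i, i \in s & rnorm (F g - F i) < e / 2.

(** Tent functions: [q i] is positive exactly where F(g) is within e of F(i). It depends on g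
    through F(g) alone, so that its quotient [p i] by the sum [Q] inherits the uniformity of F. The
    net is fine to e/2, which keeps [Q] at least e/2. *)
Let q (i g : G) : R := Num.max 0 (e - rnorm (F g - F i)).
Let Q (g : G) : R := \sum_(i <- s) q i g.
Let p (i g : G) : C := (q i g / Q g)%:C%C.

Let q_ge0 i g : 0 <= q i g. Proof. by rewrite /q le_max lexx. Qed.

Let q_le i g : q i g <= e.
Proof. by rewrite /q ge_max (ltW e0)/= gerBl rnorm_ge0. Qed.

Let q_lipschitz i g h : `|q i g - q i h| <= rnorm (F g - F h).
Proof.
rewrite (le_trans (max0_lipschitz _ _))// ler_norml.
have := rnormD (F g - F h) (F h - F i); rewrite addrA subrK.
have := rnormD (F h - F g) (F g - F i); rewrite addrA subrK (rnormB (F h) (F g)).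
lra.
Qed.

Let Q_lipschitz g h : `|Q g - Q h| <= (size s)%:R * rnorm (F g - F h).
Proof.
rewrite /Q -sumrB (le_trans (ler_norm_sum _ _ _))//.
rewrite mulr_natl -sum1_size -sumrMnr.
by rewrite ler_sum// => i _; rewrite mulr1n q_lipschitz.
Qed.

Let Q_ge g : e / 2 <= Q g.
Proof.
have [i si gi] := net g; rewrite /Q (big_rem i)//= -[e / 2]addr0 lerD//.
  by rewrite /q le_max; apply/orP; right; lra.
by rewrite sumr_ge0.
Qed.

Let Q_gt0 g : 0 < Q g.
Proof. by rewrite (lt_le_trans _ (Q_ge g))// divr_gt0. Qed.

(** The difference of quotients splits into a variation of [q i] and one of [Q]. As q <= e and 1/Q
    <= 2/e, the latter is at most e (size s) |F(g) - F(h)| (2/e)^2, whence the term 4 (size s)/e. *)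
Let p_lipschitz i g h : rnorm (p i g - p i h) <=
  (2 / e + 4 * (size s)%:R / e) * rnorm (F g - F h).
Proof.
rewrite /p -rmorphB/= rnorm_normc.
have -> : q i g / Q g - q i h / Q h =
    (q i g - q i h) / Q g + q i h * (Q h - Q g) / (Q g * Q h).
  by field; rewrite !gt_eqF.
have iQ k : (Q k)^-1 <= 2 / e.
  by rewrite -[leRHS]invf_div lef_pV2 ?posrE ?divr_gt0.
have iQ0 k : 0 <= (Q k)^-1 by rewrite invr_ge0 ltW.
rewrite (le_trans (ler_normD _ _))// [leRHS]mulrDl lerD// !normrM.
  rewrite [`|(Q g)^-1|]ger0_norm// mulrC; apply: ler_pM => //.
rewrite [`|_^-1|]ger0_norm ?invr_ge0 ?mulr_ge0 ?(ltW (Q_gt0 _))// invfM.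
have -> : 4 * (size s)%:R / e * rnorm (F g - F h) =
    e * ((size s)%:R * rnorm (F g - F h)) * (2 / e * (2 / e)).
  by field; rewrite gt_eqF.
apply: ler_pM; rewrite ?mulr_ge0//; last exact: ler_pM.
by apply: ler_pM; rewrite ?(ger0_norm (q_ge0 _ _))// -opprB normrN.
Qed.

Let RUCb_p i : RUCb (p i).
Proof.
apply/RUCbP; split.
  exists 2 => g; rewrite rnorm_normc ger0_norm ?divr_ge0 ?(ltW (Q_gt0 _))//.
  rewrite ler_pdivrMr// (le_trans (q_le i g))//.
  by have := Q_ge g; lra.
move=> s0 d d0; pose L := 2 / e + 4 * (size s)%:R / e.
have L0 : 0 < L by rewrite ltr_wpDr ?divr_ge0 ?mulr_ge0 ?(ltW e0)// divr_gt0.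
have dL : 0 < d / L by rewrite divr_gt0.
apply: filterS (rep_conj_left_uniform hrho a s0 dL) => t Ht g.
by rewrite (le_trans (p_lipschitz _ _ _))// mulrC -ler_pdivlMr.
Qed.

Let sum_p g : \sum_(i <- s) p i g = 1.
Proof.
rewrite /p -rmorph_sum/= -mulr_suml divff// gt_eqF//; exact: Q_gt0.
Qed.

(* S is the sum of mu(p_i) F(i). *)
Lemma net_average : exists S : A, forall psi (K : R), 0 <= K ->
  bounded_functional psi K -> rnorm (psi S - mu (psi \o F)) <= e * K.
Proof.
exists (\sum_(i <- s) mu (p i) *: F i) => psi K K0 bp; have [pl pK] := bp.
have psi0 : psi 0 = 0.
  by apply: (addrI (psi 0)); have := pl 1 0 0; rewrite scale1r mul1r !addr0 => <-.
have psiS : psi (\sum_(i <- s) mu (p i) *: F i) = \sum_(i <- s) psi (F i) * mu (p i).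
  elim: (s) => [|i r IH]; first by rewrite !big_nil.
  by rewrite !big_cons pl IH mulrC.
have [uS muS] := mean_sum mu_linear mu1 s (fun i => psi (F i)) RUCb_p.
have uF := RUCb_functional hrho a bp.
rewrite psiS -muS.
have -> : mu (fun g => \sum_(i <- s) psi (F i) * p i g) - mu (psi \o F) =
    mu (-1 *: (psi \o F) + (fun g => \sum_(i <- s) psi (F i) * p i g)).
  by rewrite mu_linear// mulN1r addrC.
apply: (mean_le mu_linear mu_sup); first exact: RUCb_linear.
(* As the p_i(g) sum to 1, psi(F(g)) can be moved inside the sum. *)
move=> g; rewrite [X in rnorm X](_ : _ = \sum_(i <- s) p i g * psi (F i - F g)); last first.
  transitivity (\sum_(i <- s) psi (F i) * p i g - psi (F g)).
    by rewrite -[X in _ = _ + X]mulN1r [RHS]addrC.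
  rewrite -[X in _ - X]mul1r -(sum_p g) mulr_suml -sumrB.
  by apply: eq_bigr => i _; rewrite (bounded_functionalB _ _ bp) mulrBr mulrC.
rewrite (le_trans (rnorm_sum _ _ _))//.
have pE i : rnorm (p i g) = q i g / Q g.
  by rewrite rnorm_normc ger0_norm// divr_ge0// ltW.
have -> : e * K = \sum_(i <- s) (q i g / Q g) * (e * K).
  by rewrite -mulr_suml -mulr_suml divff ?mul1r// gt_eqF//; exact: Q_gt0.
apply: ler_sum => i _; rewrite rnorm_scalarM pE.
(* Where p_i(g) does not vanish, F(i) is within e of F(g). *)
have [qi|qi] := leP (e - rnorm (F g - F i)) 0.
  by rewrite /q max_l// !mul0r.
rewrite ler_wpM2l ?divr_ge0 ?(ltW (Q_gt0 _))// (le_trans (pK _))// mulrC ler_wpM2r//.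
by rewrite rnormB; lra.
Qed.
End partition_of_unity.

(** The sums of [net_average] serve all functionals at once, so all their coefficients are close to
    the means; [phi] being isometric, sums at scales e and d are within e + d in norm, and
    converge. *)
Lemma compact_weak_average : exists b, is_weak_average rho mu phi a b.
Proof.
pose P (e : R) : set A := [set S | 0 < e /\ forall x y,
  rnorm (coefficient phi x y S - mu (coefficient phi x y \o F)) <= e * (rnorm x * rnorm y)].
have bc := coefficient_bounded phi_le.
have [||z zP] := @shrinking_limit _ _ P.
- move=> e e0; have e2 : 0 < e / 2 by rewrite divr_gt0.
  have [s net] := finite_net e2; have [S HS] := net_average e0 net.
  by exists S; split=> // x y; apply: HS; [rewrite mulr_ge0 ?rnorm_ge0|exact: bc].
- move=> e d S T [e0 PS] [d0 PT].
  apply: (coefficient_le phi_ge) => [|x y]; first by rewrite addr_ge0// ltW.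
  rewrite (bounded_functionalB _ _ (bc x y)).
  rewrite [X in rnorm X](_ : _ = (coefficient phi x y S - mu (coefficient phi x y \o F)) -
    (coefficient phi x y T - mu (coefficient phi x y \o F))).
    by rewrite (le_trans (rnormD _ _))// rnormN mulrDl lerD.
  by rewrite opprB addrA subrK.
exists z => x y; apply/eqP; rewrite -subr_eq0 -(rnorm_eq0 (_ : C)) eq_le rnorm_ge0 andbT.
apply: (@small_le0 _ _ (2 * (rnorm x * rnorm y))) => e e0.
have e2 : 0 < e / 2 by rewrite divr_gt0.
have [s net] := finite_net e2; have [S HS] := net_average e0 net.
have PS : P e S.
  by split=> // u v; apply: HS; [rewrite mulr_ge0 ?rnorm_ge0|exact: bc].
have Sz := zP _ _ PS; have [_ {}PS] := PS.
rewrite [X in rnorm X](_ : _ = (coefficient phi x y S - mu (coefficient phi x y \o F)) -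
    coefficient phi x y (S - z)).
  rewrite (le_trans (rnormD _ _))// rnormN mulrCA mulr_natl mulr2n lerD//.
  have [_ pK] := bc x y; rewrite (le_trans (pK _))// mulrC ler_wpM2r// mulr_ge0 ?rnorm_ge0//.
by rewrite (bounded_functionalB _ _ (bc x y)) opprB [RHS]addrC addrA subrK.
Qed.
End compact_average.

(** * Weak-star continuous functionals on a dual operator space *)

Lemma initial_cvg (S : choiceType) (T : topologicalType) (f : S -> T)
    (F : set_system S) (s : S) : Filter F ->
  f x @[x --> F] --> f s -> F --> (s : initial_topology f).
Proof.
move=> FF Ff A; rewrite {1}nbhsE => -[_ [[B oB <-] Bs] BA].
by apply: (@filterS _ F _ _ _ BA); apply: Ff; exact: open_nbhs_nbhs.
Qed.

Lemma ptws_cvg (I : Type) (T : topologicalType) (F : set_system (I -> T))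
    (f : I -> T) : Filter F ->
  (forall i, h i @[h --> F] --> f i) -> F --> (f : {ptws I -> T}).
Proof.
move=> FF Ff; apply/cvg_sup => i; apply: initial_cvg; exact: Ff.
Qed.

Section dual_functionals.
Context (R : realType) (X Y : operatorSpace R).
Local Notation C := (R[i]^o).
Context (J : Y -> X -> R[i]).
Hypothesis JP : is_dual_via J.

Definition os_norm1 (Z : operatorSpace R) (z : Z) : R :=
  os_norm (const_mx z : 'M[Z]_1).

Lemma os_norm1Z (Z : operatorSpace R) (c : R[i]) (z : Z) :
  os_norm1 (c *: z) = rnorm (c : C) * os_norm1 z.
Proof.
have [/(_ 0)[_ NZ _ _] _] := os_axiom Z.
by rewrite /os_norm1 -[RHS]NZ map_const_mx.
Qed.

Lemma os_norm1_0 (Z : operatorSpace R) : os_norm1 (0 : Z) = 0.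
Proof. by rewrite -(scale0r 0) os_norm1Z rnorm0 mul0r. Qed.

Lemma os_norm1_ge0 (Z : operatorSpace R) (z : Z) : 0 <= os_norm1 z.
Proof.
have [/(_ 0)[ND _ _ _] _] := os_axiom Z.
have : os_norm1 (z - z) <= os_norm1 z + os_norm1 (- z).
  by rewrite /os_norm1 (le_trans _ (ND _ _))// raddfD.
rewrite subrr -scaleN1r os_norm1Z os_norm1_0 rnormN.
by rewrite /rnorm normr1/= mul1r; lra.
Qed.

Lemma os_norm1_eq0 (Z : operatorSpace R) (z : Z) : os_norm1 z = 0 -> z = 0.
Proof.
have [/(_ 0)[_ _ N0 _] _] := os_axiom Z.
by move=> /N0/matrixP/(_ 0 0); rewrite !mxE.
Qed.

Lemma duality_linearl (a : R[i]) y z x : J (a *: y + z) x = a * J y x + J z x.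
Proof. by have [] := JP. Qed.

Lemma duality_dual y : dual_space (J y).
Proof. by have [_ <- _] := JP; exists y. Qed.

Lemma duality_linearr (a : R[i]) y x z : J y (a *: x + z) = a * J y x + J y z.
Proof. by have [+ _] := duality_dual y; apply. Qed.

Lemma duality0l x : J 0 x = 0.
Proof.
apply: (addrI (J 0 x)); rewrite addr0 -[X in X + _]mul1r -duality_linearl.
by rewrite scaler0 addr0.
Qed.

(* [cbnorm] is 0 where the supremum is infinite; then y = 0 as the norm of Y
   is definite. *)
Lemma duality_bound y x : rnorm (J y x : C) <= os_norm1 x * os_norm1 y.
Proof.
have [_ _ /(_ 0 (const_mx y)) cbJ] := JP.
have J0 : J y 0 = 0.
  apply: (addrI (J y 0)); rewrite addr0 -[X in X + _]mul1r -duality_linearr.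
  by rewrite scaler0 addr0.
have [->|x0] := eqVneq x 0; first by rewrite J0 rnorm0 mulr_ge0 ?os_norm1_ge0.
have nx : 0 < os_norm1 x.
  rewrite lt_neqAle os_norm1_ge0 eq_sym andbT; apply: contra x0 => /eqP.
  by move=> /os_norm1_eq0->.
pose k := (os_norm1 x)^-1; have k0 : 0 <= k by rewrite invr_ge0 ltW.
pose x' := k%:C%C *: x.
have x'1 : os_norm1 x' = 1.
  by rewrite os_norm1Z rnorm_normc ger0_norm// mulVf// gt_eqF.
have JZ : rnorm (J y x' : C) = k * rnorm (J y x : C).
  rewrite -[x']addr0 duality_linearr J0 addr0 rnorm_scalarM rnorm_normc.
  by rewrite ger0_norm.
suff H : rnorm (J y x' : C) <= os_norm1 y.
  by move: H; rewrite JZ mulrC ler_pdivrMr// mulrC.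
rewrite -[leRHS]cbJ /cbnorm; set S := [set r | _].
have [bS|/sup_out S0] := pselect (has_sup S); last first.
  have : y = 0 by apply: os_norm1_eq0; rewrite -[LHS]cbJ /cbnorm -/S S0.
  by move=> ->; rewrite S0 duality0l rnorm0.
pose T (p q : 'I_1 * 'I_1) (z : C) : C := J y x' * z.
have h1 i : i = (ord0, ord0) :> 'I_1 * 'I_1 by case: i => u v; rewrite !ord1.
have /le_trans -> // : rnorm (J y x' : C) <= mxopnorm T.
  have r1 : rnorm (1 : C) = 1 by rewrite /rnorm normr1.
  have := @mxopnorm_ge _ _ _ _ h1 T (rnorm (J y x' : C)) (1 : C).
  rewrite r1 mulr1 /T mulr1; apply=> [a z|z]; last by rewrite rnorm_scalarM.
  by rewrite -[RHS]/(a * (J y x' * z)) mulrCA.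
apply: ub_le_sup; first exact: bS.2.
exists 0, (const_mx x'); split; first by rewrite -[leLHS]/(os_norm1 x') x'1.
by congr mxopnorm; apply/funext => p; apply/funext => q; apply/funext => z;
  rewrite /T !mxE.
Qed.

(* A functional vanishing on the common kernel of finitely many evaluations is a
   linear combination of them. *)
Lemma duality_span (s : seq X) (f : Y -> C) :
  (forall a y z, f (a *: y + z) = a * f y + f z) ->
  (forall y, (forall x, x \in s -> J y x = 0) -> f y = 0) ->
  exists x, forall y, f y = J y x.
Proof.
elim: s f => [|x s IH] f fl fs.
  exists 0 => y; rewrite fs//; apply/esym/(addrI (J y 0)).
  by rewrite addr0 -[X in X + _]mul1r -duality_linearr scaler0 addr0.
have [[y0 [y0s y0x]]|ns] := pselect (exists y0, (forall z, z \in s -> J y0 z = 0) /\ J y0 x != 0).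
  (* f - t J(.)(x) vanishes on the common kernel of [s]: a multiple of [y0] moves y into the kernel
     of the evaluation at x as well. If there is no such [y0], x adds no condition. *)
  pose t := f y0 / J y0 x.
  have [||x' x'E] := IH (fun y => f y - t * J y x).
  - by move=> a y z; rewrite fl duality_linearl; ring.
  - move=> y ys.
    have : f (- (J y x / J y0 x) *: y0 + y) = 0.
      apply: fs => z; rewrite inE duality_linearl => /orP[/eqP->|zs].
        by rewrite mulNr divfK// addNr.
      by rewrite (y0s z)// (ys z)// mulr0 addr0.
    rewrite fl => <-; rewrite /t; ring.
  exists (t *: x + x') => y.
  by rewrite duality_linearr -x'E addrC subrK.
apply: IH => // y ys; apply: fs => z; rewrite inE => /orP[/eqP->|/ys//].
by apply/eqP; apply: contrapT => /negP Jx; apply: ns; exists y.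
Qed.

(** By continuity f is bounded where finitely many evaluations are small, hence by scaling vanishes
    on their common kernel and lies in their span. [F0] is the filter of these basic neighbourhoods
    of 0; its weak-star convergence to 0 is what transfers the continuity of f. *)
Lemma weakstar_functional (f : Y -> C) :
  (forall a y z, f (a *: y + z) = a * f y + f z) ->
  continuous (f : weakstar J -> C) ->
  exists x, forall y, f y = J y x.
Proof.
move=> fl cf.
pose F0 : set_system Y := fun S => exists (s : seq X) (e : R), 0 < e /\
  forall y, (forall x, x \in s -> rnorm (J y x : C) < e) -> S y.
have FF : Filter F0.
  split=> [|S T [s [e [e0 sS]]] [t [d [d0 tT]]]|S T ST [s [e [e0 sS]]]].
  - by exists [::], 1.
  - exists (s ++ t), (Num.min e d); split=> [|y H]; first by rewrite lt_min e0.
    split; [apply: sS|apply: tT] => x xs.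
      by have /H : x \in s ++ t by [rewrite mem_cat xs]; rewrite lt_min => /andP[].
    by have /H : x \in s ++ t by [rewrite mem_cat xs orbT]; rewrite lt_min => /andP[].
  - by exists s, e; split=> // y /sS/ST.
have F0cvg : cvg_to F0 (nbhs (0 : weakstar J)).
  apply: initial_cvg; apply: ptws_cvg => x.
  apply/cvgrPdist_lt => e e0.
  have eE : e = (complex.Re e)%:C%C.
    by move: e0; case: e => u v; rewrite ltcE/= => /andP[/eqP -> _].
  rewrite eE ltcR in e0; exists [:: x], (complex.Re e); split=> // y /(_ x).
  rewrite mem_head /= duality0l sub0r normrN [X in _ -> _ < X]eE => /(_ isT).
  by rewrite -(rnormE (J y x : C)) ltcR.
have f0 : f 0 = 0.
  by apply: (addrI (f 0)); rewrite addr0 -[X in X + _]mul1r -fl scaler0 addr0.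
have : F0 [set y | rnorm (f y) < 1].
  apply: (F0cvg _ (cf 0 [set z : C | rnorm z < 1] _)).
  rewrite f0; apply/nbhs_ballP; exists 1 => //= z.
  by rewrite -ball_normE/= sub0r normrN -(rnormE (z : C)) ltcR.
move=> [s [e [e0 sf]]]; apply: (duality_span (s := s) fl) => y ys.
apply/eqP; rewrite -(rnorm_eq0 (f y)) eq_le rnorm_ge0 andbT.
apply: (@small_le0 _ _ 1) => d d0; rewrite mulr1.
have : rnorm (f ((d^-1)%:C%C *: y + 0)) < 1.
  apply: sf => x xs; rewrite duality_linearl ys// mulr0 add0r duality0l.
  by rewrite rnorm0.
rewrite fl f0 addr0 rnorm_scalarM rnorm_normc ger0_norm ?invr_ge0 ?(ltW d0)//.
by rewrite mulrC ltr_pdivrMr// mul1r => /ltW.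
Qed.
End dual_functionals.

(** * Ultraweak continuity of coefficients *)

Section ultraweak_coefficients.
Context (R : realType) (H : hilbertSpace R).
Local Notation C := (R[i]^o).

Lemma series_single (K : numFieldType) (V : normedModType K) (u : nat -> V) :
  (forall k, (0 < k)%N -> u k = 0) -> series u @ \oo --> u 0%N.
Proof.
move=> u0; apply: cvg_near_cst; exists 1%N => // n /= n1.
rewrite /series/= big_ltn// big_nat big1 ?addr0// => k /andP[k1 _].
exact: u0.
Qed.

(* With these sequences a vector functional T |-> <Tx, y> becomes a trace
   functional. *)
Definition delta_seq (x : H) (k : nat) : H := if k is 0%N then x else 0.

Lemma delta_seq_summable (x : H) : square_summable (delta_seq x).
Proof.
apply/cvg_ex; eexists; apply: series_single => -[//|k] _ /=.
by rewrite rnorm0 expr0n.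
Qed.

Lemma ultraweak_coefficient (x y : H) :
  continuous ((fun T : blin H H => inner (T x) y) : ultraweak H -> C).
Proof.
pose p : @square_summable R H `*` @square_summable R H := exist _ (delta_seq x, delta_seq y)
  (mem_set (conj (@delta_seq_summable x) (@delta_seq_summable y))).
have -> : (fun T : blin H H => inner (T x) y : C) =
    (fun h : {ptws (@square_summable R H `*` @square_summable R H) -> C} => h p) \o
    (@trace_functional R H).
  apply/funext => T /=; rewrite /trace_functional; apply/esym/cvg_lim => //.
  rewrite -[X in _ --> X]/((fun k => inner (T ((\val p).1 k)) ((\val p).2 k) : C) 0%N).
  by apply: series_single => -[//|k] _ /=; rewrite linear0 inner0l.
move=> T; apply: continuous_comp; first exact: initial_continuous.
exact: (@proj_continuous _ (fun=> C) p).
Qed.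
End ultraweak_coefficients.

(** * Isometric representations and averages in dual operator algebras *)

Section operator_norm.
Context (R : realType) (A : unitalOperatorAlgebra R) (H : hilbertSpace R).
Context (phi : {linear A -> blin H H}).
Hypothesis ci : completely_isometric (@oa_norm R A) phi.

Let opnormE a : mxopnorm (fun i j : 'I_1 => phi ((const_mx a : 'M[A]_1) i j)) = rnorm a.
Proof. by rewrite ci oa_norm1. Qed.

Lemma isometric_le a x : rnorm (phi a x) <= rnorm a * rnorm x.
Proof.
have [K K0 pK] := blin_bounded (phi a).
have := @mxopnorm_ge _ _ _ _ (@ord1 : forall i : 'I_1, i = ord0)
  (fun i j => phi ((const_mx a : 'M[A]_1) i j)) K x.
rewrite opnormE !mxE; apply=> // c y; exact: linearZ.
Qed.

Lemma isometric_ge a (K : R) : 0 <= K ->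
  (forall x, rnorm (phi a x) <= K * rnorm x) -> rnorm a <= K.
Proof.
move=> K0 aK; rewrite -opnormE.
by apply: (mxopnorm_le (@ord1 : forall i : 'I_1, i = ord0)) => // y; rewrite mxE.
Qed.
End operator_norm.

Section dual_average.
Context (R : realType) (G : topologicalGroupType) (A : unitalOperatorAlgebra R).
Context (rho : G -> units A).
Hypothesis hrho : bounded_reps rho.
Local Notation C := (R[i]^o).
Context (mu : (G -> C) -> C).
Hypothesis mu_linear : forall (a : R[i]) f h, RUCb f -> RUCb h ->
  mu (a *: f + h) = a * mu f + mu h.
Hypothesis mu_sup :
  sup [set rnorm (mu f) | f in @RUCb R G `&` [set f | supnorm f <= 1]] = 1.
Context (X : operatorSpace R) (J : oa_space A -> X -> R[i]).
Hypothesis JP : is_dual_via J.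
Context (H : hilbertSpace R) (phi : {linear A -> blin H H}).
Hypothesis phi_cont : continuous (phi : weakstar J -> ultraweak H).

Let os_normE (a : A) : os_norm1 (a : oa_space A) = rnorm a.
Proof. exact: oa_norm1. Qed.

Lemma evaluation_bounded x :
  bounded_functional (fun a : A => J a x : C) (os_norm1 x).
Proof.
split=> [c a b|a]; first exact: (duality_linearl JP).
by rewrite -os_normE; exact: (duality_bound JP).
Qed.

(** The element b with J(b) = L averages correctly against evaluations at the predual. Weak-star
    continuity of [phi] makes each coefficient such an evaluation, at some z. *)
Lemma dual_weak_average a : exists b, is_weak_average rho mu phi a b.
Proof.
have uJ x := RUCb_functional hrho a (evaluation_bounded x).
pose L x : R[i] := mu ((fun a : A => J a x : C) \o rep_conj rho a).
have [b bL] : exists b : A, J b = L.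
  have [_ JD _] := JP.
  suff : dual_space L by rewrite -JD => -[b _ <-]; exists b.
  split=> [c x y|].
    rewrite /L -mu_linear//; congr mu; apply/funext => g /=.
    exact: (duality_linearr JP).
  have [K K0 rK] := rep_conj_bounded hrho.
  exists (K * rnorm a) => x; rewrite -/(os_norm1 x).
  apply: (mean_le mu_linear mu_sup (uJ x)) => g /=.
  have [_ Jb] := evaluation_bounded x.
  by rewrite (le_trans (Jb _))// mulrC ler_wpM2r ?os_norm1_ge0.
exists b => x y.
have [z zE] : exists z, forall c : A, coefficient phi x y c = J c z.
  apply: (weakstar_functional JP).
    move=> c u v; rewrite /coefficient linearP.
    by rewrite -[blin_fun _ x]/(c *: phi u x + phi v x) inner_linear.
  have -> : coefficient phi x y = (fun T : blin H H => inner (T x) y) \o phi by [].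
  move=> c; apply: (@continuous_comp (weakstar J) (ultraweak H) C phi).
    exact: phi_cont.
  exact: ultraweak_coefficient.
rewrite zE bL /L; congr mu; apply/funext => g /=.
by rewrite zE.
Qed.
End dual_average.

(** Naturality is expressed by the orbit maps a |-> act(a, x) being submersions, which determines
    the manifold structure; e identifies M with the orbit. *)
Theorem corollary3p10 (R : realType) (A : unitalOperatorAlgebra R)
    (G : topologicalGroupType) (amenG : amenable R G)
    (hAG : dual_operator_algebra A \/ compact [set: G])
    (rho : G -> units A) (hrho : bounded_reps rho) :
  banach_lie_group (units_atlas A) /\
  exists (M : topologicalType) (AM : atlas R M) (e : M -> G -> units A)
      (act : units A * M -> M),
    [/\ banach_manifold AM,
        injective e /\ range e = conj_orbit rho,
        forall a x, e (act (a, x)) = conj_rep a (e x),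
        smooth_action (units_atlas A) AM act &
        forall x, submersion (units_atlas A) AM (fun a => act (a, x))].
Proof.
split; first exact: banach_lie_group_units.
have [mu [mu_linear mu_sup mu1 mu_inv]] := amenG.
(* The two conditions enter through the existence of weak averages. In the dual case [phi] has to be
   the weak-star continuous representation. *)
have [H [phi [phiM ci wa]]] : exists (H : hilbertSpace R) (phi : {linear A -> blin H H}),
    [/\ homomorphism phi, completely_isometric (@oa_norm R A) phi &
      forall a, exists b, is_weak_average rho mu phi a b].
  case: hAG => [[X [J [JP [H [phi [phiM ci cphi]]]]]]|cG].
    exists H, phi; split=> // a.
    exact: (dual_weak_average hrho mu_linear mu_sup JP cphi).
  have [H [phi [phiM ci]]] := oa_axiom A; exists H, phi; split=> // a.
  exact: (compact_weak_average hrho mu_linear mu_sup mu1 (isometric_le ci)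
    (isometric_ge ci) cG).
have [E [E_comm E_mulr E1]] := expectation_exists hrho mu_linear mu_sup mu1 mu_inv
  phiM (isometric_le ci) (isometric_ge ci) wa.
exists (orbit rho), (orbit_atlas E_comm E_mulr E1), (@orbit_val R A G rho),
  (@orbit_act R A G rho); split.
- exact: orbit_banach_manifold.
- by split; [exact: orbit_val_inj|exact: range_orbit_val].
- exact: orbit_val_act.
- by split; [exact: orbit_act1|exact: orbit_actM|exact: smooth_orbit_act].
- exact: submersion_orbit_act.
Qed.
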